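(* Let $\Omega\subset\mathbb{C}^d$ be a bounded $\mathbb{C}$-strictly convex domain with $C^{1,\alpha}$ boundary (for some $\alpha\in(0,1]$). Then every complex geodesic $\varphi:\Delta\to\Omega$ extends to a continuous map $\overline\varphi:\overline\Delta\to\overline\Omega$.
   Context: $\Delta=\{z\in\mathbb{C}:|z|<1\}$. $K_\Omega$ is the Kobayashi distance on $\Omega$, with $K_\Delta(\zeta_1,\zeta_2)=\tanh^{-1}\left|\frac{\zeta_1-\zeta_2}{1-\zeta_1\bar\zeta_2}\right|$. A complex geodesic is a holomorphic map $\varphi:\Delta\to\Omega$ with $K_\Omega(\varphi(z),\varphi(w))=K_\Delta(z,w)$ for all $z,w\in\Delta$. A convex domain $\Omega$ is $\mathbb{C}$-strictly convex if every supporting complex hyperplane intersects $\partial\Omega$ at exactly one point. *)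

(* Defs.v *)
From HB Require Import structures.
From mathcomp Require Import all_boot all_order all_algebra.
From mathcomp Require Import all_classical all_reals all_analysis.
From mathcomp Require Import complex.
Import Order.TTheory GRing.Theory Num.Theory numFieldNormedType.Exports.

Set Implicit Arguments.
Unset Strict Implicit.
Unset Printing Implicit Defensive.

Local Open Scope classical_set_scope.
Local Open Scope ring_scope.

(* [R[i]] carries no topology of its own: it gets one, and becomes a normed
   module over itself, once seen as a [numClosedFieldType]. On ['rV[Cx R]_d]
   the norm is then the sup norm, which induces the usual topology of C^d. *)
Definition Cx (R : realType) : numClosedFieldType := R[i].

Definition unit_disc (R : realType) : set (Cx R) := [set z | `|z| < 1].
Arguments unit_disc R : clear implicits.

(* inverse hyperbolic tangent on ]-1, 1[ *)
Definition artanh (R : realType) (x : R) : R := ln ((1 + x) / (1 - x)) / 2.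

(* [Normc.normc] is the complex modulus with values in [R] (whereas [`|_|] takes
   values in [Cx R]). *)
Definition poincare_dist (R : realType) (z w : Cx R) : R :=
  artanh (Normc.normc ((z - w) / (1 - z * w^*) : Cx R)).

(* A holomorphic map from the unit disc to [Omega] is given by a total function
   whose values off the disc are irrelevant. The scalars are complex, so that
   [derivable f z 1] is complex differentiability at [z]. *)
Definition holomorphic_disc (R : realType) (d : nat) (Omega : set 'rV[Cx R]_d)
    (f : Cx R -> 'rV[Cx R]_d) : Prop :=
  forall z, unit_disc R z -> derivable f z 1 /\ Omega (f z).

(* Chains of [n] holomorphic discs in [Omega] through [p 0], ..., [p n]. *)
Definition disc_chain (R : realType) (d : nat) (Omega : set 'rV[Cx R]_d)
    (n : nat) (p : nat -> 'rV[Cx R]_d) (f : nat -> Cx R -> 'rV[Cx R]_d)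
    (a b : nat -> Cx R) : Prop :=
  forall i, (i < n)%N ->
    [/\ holomorphic_disc Omega (f i), unit_disc R (a i), unit_disc R (b i),
        f i (a i) = p i & f i (b i) = p i.+1].

Definition kobayashi_dist (R : realType) (d : nat) (Omega : set 'rV[Cx R]_d)
    (x y : 'rV[Cx R]_d) : \bar R :=
  ereal_inf [set l | exists n p f a b,
    [/\ (0 < n)%N, disc_chain Omega n p f a b, p 0%N = x, p n = y &
        l = (\sum_(i < n) poincare_dist (a i) (b i))%:E]].

Definition complex_geodesic (R : realType) (d : nat) (Omega : set 'rV[Cx R]_d)
    (phi : Cx R -> 'rV[Cx R]_d) : Prop :=
  holomorphic_disc Omega phi /\
  forall z w, unit_disc R z -> unit_disc R w ->
    kobayashi_dist Omega (phi z) (phi w) = (poincare_dist z w)%:E.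

Definition domain (R : realType) (d : nat) (Omega : set 'rV[Cx R]_d) : Prop :=
  [/\ open Omega, connected Omega & Omega !=set0].

Definition boundary (T : topologicalType) (A : set T) : set T :=
  closure A `\` interior A.

Definition complex_hyperplane (R : realType) (d : nat)
    (H : set 'rV[Cx R]_d) : Prop :=
  exists (a : 'cV[Cx R]_d) (c : Cx R),
    a != 0 /\ H = [set z | (z *m a) ord0 ord0 = c].

Definition supporting_complex_hyperplane (R : realType) (d : nat)
    (Omega H : set 'rV[Cx R]_d) : Prop :=
  [/\ complex_hyperplane H, H `&` boundary Omega !=set0 & H `&` Omega = set0].

(* [convex_set] is taken over the scalars [Cx R]; as [0 <= t <= 1] in the
   (partial) order of [Cx R] forces [t] to be real, it is usual convexity. *)
Definition C_strictly_convex (R : realType) (d : nat)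
    (Omega : set 'rV[Cx R]_d) : Prop :=
  convex_set Omega /\
  forall H, supporting_complex_hyperplane Omega H ->
    exists p, H `&` boundary Omega = [set p].

Definition realify (R : realType) (d : nat) (z : 'rV[Cx R]_d) :
    'rV[R]_d * 'rV[R]_d :=
  (map_mx (fun c : Cx R => complex.Re c) z,
   map_mx (fun c : Cx R => complex.Im c) z).

(* Near each boundary point, [Omega] is the sublevel set of a real function of
   class C^{1,alpha} with nowhere vanishing differential. *)
Definition C1_holder_boundary (R : realType) (d : nat) (alpha : R)
    (Omega : set 'rV[Cx R]_d) : Prop :=
  forall p, boundary Omega p ->
    exists (U : set ('rV[R]_d * 'rV[R]_d))
           (rho : 'rV[R]_d * 'rV[R]_d -> R) (M : R),
      [/\ open U /\ U (realify p),
          forall x, U x -> differentiable rho x,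
          forall x, U x -> exists v, 'd rho x v != 0,
          forall x y v, U x -> U y ->
            `|'d rho x v - 'd rho y v| <= M * `|x - y| `^ alpha * `|v| &
          forall z, U (realify z) -> (Omega z <-> rho (realify z) < 0)].

(* Main.v *)
Require Import Defs.
From mathcomp Require Import all_boot all_order all_algebra.
From mathcomp Require Import all_classical all_reals all_analysis.
From mathcomp Require Import complex ring lra.
Import Order.TTheory GRing.Theory Num.Theory numFieldNormedType.Exports.
Set Implicit Arguments.
Unset Strict Implicit.
Unset Printing Implicit Defensive.
Local Open Scope classical_set_scope.
Local Open Scope ring_scope.

(** The boundary is uniformly regular: at every boundary point p there is a complex linear form
    ell_p with Re ell_p(y - p) > 0 for y in Omega, and p + v is in Omega for all small v with
    Re ell_p(v) > K |v|^(1+alpha).  Joining phi(z) to phi(0) by affine discs through this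
    region gives K_Omega(phi(z), phi(0)) <= - (1/2) log delta(phi(z)) + C with delta the distance
    to the boundary.  Since phi is a geodesic, delta(phi(z)) <= C (1 - |z|).

    Let p be a boundary point nearest to phi(z).  The scalar function g(w) = ell_p(phi(w) - p) maps
    the disc to the right half-plane and g(z) = delta(phi(z)).  Schwarz-Pick yields
    |g(u) - g(z)|^2 <= C |u - z|^2 / (1 - |u|), so moving z radially inwards by h changes g
    by O(sqrt h).  C-strict convexity and compactness turn a small value ell_p(phi(u) - p) into a small
    distance |phi(u) - p|, uniformly in p.  Hence phi is uniformly continuous.

    Schwarz-Pick is derived from Goursat's theorem on rectangles: integrating (1 - F(w))/w around a
    square shows |F| > 1/4 somewhere on the boundary when F(0) = 1; applying this to powers
    of F removes the constant, and yields the maximum modulus principle. *)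

(** * Real-valued norms *)

(** The factor 1/2 in front of the logarithm has to be exact. In Schwarz-Pick for g the factor 1 -
    |z| on the left is cancelled by Re g(z) = delta(phi(z)) <= C (1 - |z|); a smaller power of 1 -
    |z| would leave a bound that blows up at the circle. For alpha < 1 the boundary need not admit
    inner tangent balls, so no single disc yields this factor. A round disc is used at each scale,
    only where it resembles a half-plane, and the Hölder exponent makes the errors summable.

    C-strict convexity restricts complex hyperplanes only, so the whole complex number ell_p(phi(u)
    - p) must be small, not just its real part. For this ell_p is normalised to norm one; since p is
    a nearest boundary point, g(z) is then real and equal to delta(phi(z)). As p varies with z,
    every constant must be independent of p.

    Two points near the circle are compared through one common point deeper in the disc. *)

Section RealNorm.
Variables (R : realType) (V : normedModType (Cx R)).
Implicit Types (u v : V) (a : Cx R).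

(** The norm lives in the partially ordered field [Cx R]; its real part is an honest real number,
    open to real inequalities and their tactics. *)
Definition nm (U : normedModType (Cx R)) (v : U) : R := complex.Re `|v|.

Lemma normE v : `|v| = (nm v)%:C%C.
Proof.
have /ger0_Im : 0 <= `|v| by rewrite normr_ge0.
by rewrite /nm; case: (`|v|) => a b /= ->.
Qed.

Lemma nm_ge0 v : 0 <= nm v.
Proof. by rewrite -ler0c -normE normr_ge0. Qed.

Lemma nm0 : nm (0 : V) = 0.
Proof. by rewrite /nm normr0. Qed.

Lemma nm_eq0 v : (nm v == 0) = (v == 0).
Proof.
by rewrite -(inj_eq (@complexI R)) -normE normr_eq0.
Qed.

Lemma nm_gt0 v : (0 < nm v) = (v != 0).
Proof. by rewrite lt_def nm_ge0 nm_eq0 andbT. Qed.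

Lemma nmD u v : nm (u + v) <= nm u + nm v.
Proof. by rewrite -lecR rmorphD /= -!normE ler_normD. Qed.

Lemma nmN v : nm (- v) = nm v.
Proof. by rewrite /nm normrN. Qed.

Lemma nm_distC u v : nm (u - v) = nm (v - u).
Proof. by rewrite /nm distrC. Qed.

Lemma nmB u v : nm (u - v) <= nm u + nm v.
Proof. by rewrite -[X in _ <= _ + X]nmN; exact: nmD. Qed.

Lemma nm_triangle w u v : nm (u - v) <= nm (u - w) + nm (w - v).
Proof. by rewrite -(subrKA w) nmD. Qed.

Lemma nmBB u v : `|nm u - nm v| <= nm (u - v).
Proof.
rewrite ler_norml; apply/andP; split.
  by have := nm_triangle 0 v 0; have := nmD (v - u) u; rewrite subrK nm_distC; lra.
by have := nmD (u - v) v; rewrite subrK; lra.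
Qed.

Lemma nmZ a v : nm (a *: v) = nm a * nm v.
Proof.
apply: (@complexI R); rewrite rmorphM /= -!normE normrZ.
by congr (_ * _).
Qed.

(** A positive element of [Cx R] is real, so real radii give all balls. *)
Lemma nbhs_nmP v (A : set V) :
  nbhs v A <-> exists2 e : R, 0 < e & forall u, nm (u - v) < e -> A u.
Proof.
rewrite -nbhs_ballE; split.
  move=> [e /= e0]; rewrite -ball_normE => sA; exists (complex.Re e); first by move: e0; rewrite ltcE => /andP[].
  move=> u uv; apply: sA => /=.
  have -> : e = (complex.Re e)%:C%C.
    have /ger0_Im := ltW e0; by case: (e) => ? ? /= ->.
  by rewrite normE ltcR nm_distC.
move=> [e e0 sA]; exists (e%:C%C : Cx R); first by rewrite /= ltcR.
by rewrite -ball_normE => u /=; rewrite normE ltcR nm_distC; exact: sA.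
Qed.

Lemma closed_nmP (A : set V) :
  closed A <-> forall v, (forall e : R, 0 < e -> exists2 u, A u & nm (u - v) < e) -> A v.
Proof.
split=> [cA v h|h v cv].
  apply: cA => B /nbhs_nmP[e e0 sB]; have [u Au uv] := h e e0.
  by exists u; split => //; exact: sB.
apply: h => e e0; have [|u [Au uv]] := cv [set u | nm (u - v) < e].
  by apply/nbhs_nmP; exists e.
by exists u.
Qed.

Lemma closure_nmP (A : set V) v :
  closure A v <-> forall e : R, 0 < e -> exists2 u, A u & nm (u - v) < e.
Proof.
split=> [cv e e0|h B /nbhs_nmP[e e0 sB]].
  have [|u [Au uv]] := cv [set u | nm (u - v) < e].
    by apply/nbhs_nmP; exists e.
  by exists u.
by have [u Au uv] := h e e0; exists u; split => //; exact: sB.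
Qed.

Lemma open_nmP (A : set V) :
  open A <-> forall v, A v -> exists2 e : R, 0 < e & forall u, nm (u - v) < e -> A u.
Proof.
by rewrite openE; split => h v Av; [apply/nbhs_nmP/h | apply/nbhs_nmP/h].
Qed.

End RealNorm.

Lemma cvg_nmP (R : realType) (T : Type) (F : set_system T) (FF : Filter F)
    (V : normedModType (Cx R)) (f : T -> V) (l : V) :
  f @ F --> l <-> forall e : R, 0 < e -> \forall t \near F, nm (f t - l) < e.
Proof.
split=> [fl e e0|h A /nbhs_nmP[e e0 sA]].
  by apply: (fl [set u | nm (u - l) < e]); apply/nbhs_nmP; exists e.
by apply: filterS (h e e0) => t /sA.
Qed.

Lemma continuous_nmP (R : realType) (U V : normedModType (Cx R)) (f : U -> V) x :
  {for x, continuous f} <->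
  forall e : R, 0 < e -> exists2 d : R, 0 < d & forall y, nm (y - x) < d -> nm (f y - f x) < e.
Proof.
by split=> [/cvg_nmP h e e0|h]; [apply/nbhs_nmP/h | apply/cvg_nmP => e e0; apply/nbhs_nmP/h].
Qed.

Lemma continuous_nm (R : realType) (V : normedModType (Cx R)) :
  continuous (fun v : V => nm v : R^o).
Proof.
move=> v; apply/cvgrPdist_lt => e e0; apply/nbhs_nmP; exists e => // u uv.
by rewrite /= distrC (le_lt_trans (nmBB _ _)).
Qed.

Section ComplexNorm.
Variable R : realType.
Implicit Types z w : Cx R.
Local Notation Re := complex.Re.
Local Notation Im := complex.Im.

Lemma nmE z : nm z = Normc.normc z.
Proof. by case: z. Qed.

Lemma nm_sqr z : nm z ^+ 2 = Re z ^+ 2 + Im z ^+ 2.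
Proof. by case: z => a b; rewrite nmE /= sqr_sqrtr // addr_ge0 ?sqr_ge0. Qed.

Lemma nmM z w : nm (z * w) = nm z * nm w.
Proof. by rewrite !nmE Normc.normcM. Qed.

Lemma nmV z : nm z^-1 = (nm z)^-1.
Proof. by rewrite !nmE Normc.normcV. Qed.

Lemma nm1 : nm (1 : Cx R) = 1.
Proof. by rewrite nmE Normc.normc1. Qed.

Lemma nmX z n : nm (z ^+ n) = nm z ^+ n.
Proof. by elim: n => [|n ih]; rewrite ?expr0 ?nm1// !exprS nmM ih. Qed.

Lemma nm_real (x : R) : nm (x%:C%C : Cx R) = `|x|.
Proof. by rewrite nmE /= expr0n addr0 sqrtr_sqr. Qed.

Lemma ReD z w : Re (z + w) = Re z + Re w.
Proof. by case: z w => [a b] [c d]. Qed.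
Lemma ImD z w : Im (z + w) = Im z + Im w.
Proof. by case: z w => [a b] [c d]. Qed.
Lemma ReN z : Re (- z) = - Re z.
Proof. by case: z. Qed.
Lemma ImN z : Im (- z) = - Im z.
Proof. by case: z. Qed.
Lemma ReM z w : Re (z * w) = Re z * Re w - Im z * Im w.
Proof. by case: z w => [a b] [c d]. Qed.
Lemma ImM z w : Im (z * w) = Re z * Im w + Im z * Re w.
Proof. by case: z w => [a b] [c d]. Qed.
Lemma ReJ z : Re z^* = Re z.
Proof. by case: z. Qed.
Lemma ImJ z : Im z^* = - Im z.
Proof. by case: z. Qed.

Definition ReImE := (ReD, ImD, ReN, ImN, ReM, ImM, ReJ, ImJ).

Lemma eqC z w : Re z = Re w -> Im z = Im w -> z = w.
Proof. by case: z w => [a b] [c d] /= -> ->. Qed.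

Lemma nmJ z : nm z^* = nm z.
Proof. by case: z => a b; rewrite !nmE /= sqrrN. Qed.

Lemma le_Re_nm z : `|Re z| <= nm z.
Proof.
rewrite -(ler_pXn2r (n := 2)) ?nnegrE ?nm_ge0// nm_sqr real_normK ?num_real//.
by rewrite lerDl sqr_ge0.
Qed.

Lemma le_Im_nm z : `|Im z| <= nm z.
Proof.
rewrite -(ler_pXn2r (n := 2)) ?nnegrE ?nm_ge0// nm_sqr real_normK ?num_real//.
by rewrite lerDr sqr_ge0.
Qed.

Lemma le_nm_ReIm z : nm z <= `|Re z| + `|Im z|.
Proof.
rewrite -(ler_pXn2r (n := 2)) ?nnegrE ?nm_ge0 ?addr_ge0// nm_sqr sqrrD.
rewrite !real_normK ?num_real// -addrA [X in _ <= _ + X]addrC addrA lerDl.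
by rewrite mulrn_wge0 ?mulr_ge0.
Qed.

Lemma nm_leX2 z (x : R) : 0 <= x -> (nm z <= x) = (Re z ^+ 2 + Im z ^+ 2 <= x ^+ 2).
Proof. by move=> x0; rewrite -nm_sqr ler_pXn2r ?nnegrE ?nm_ge0. Qed.

Lemma unit_discE z : unit_disc R z <-> nm z < 1.
Proof. by rewrite /unit_disc /= normE -[1]/(1%:C%C) ltcR. Qed.

End ComplexNorm.

(** * Goursat's theorem on rectangles *)

Section SegmentIntegral.
Variable R : realType.
Implicit Types (f g : R -> R) (a b k : R).

Definition sint f a b : R :=
  \int[@lebesgue_measure R]_(t in `[a, b]) f t.

Lemma sint_integrable f a b : {within `[a, b], continuous (f : R -> R^o)} ->
  (@lebesgue_measure R).-integrable `[a, b] (EFin \o f).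
Proof.
by move=> cf; apply: continuous_compact_integrable => //; exact: segment_compact.
Qed.

Lemma sint_split f a m b : a <= m -> m <= b ->
  {within `[a, b], continuous (f : R -> R^o)} ->
  sint f a b = sint f a m + sint f m b.
Proof.
move=> am mb cf; have fi := sint_integrable cf.
have := @Rintegral_itvB R f (BLeft a) (BRight b) m fi.
rewrite !bnd_simp => /(_ am mb).
rewrite Rintegral_itv_obnd_cbnd.
  by rewrite /sint => <-; rewrite addrC subrK.
apply: integrableS fi => //.
by apply: subset_itvr; rewrite bnd_simp.
Qed.

Lemma sintB f g a b : {within `[a, b], continuous (f : R -> R^o)} ->
  {within `[a, b], continuous (g : R -> R^o)} ->
  sint (fun t => f t - g t) a b = sint f a b - sint g a b.
Proof.
by move=> cf cg; apply: RintegralB => //; exact: sint_integrable.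
Qed.

Lemma sint_cst k a b : a <= b -> sint (fun=> k) a b = k * (b - a).
Proof.
move=> ab; rewrite /sint Rintegral_cst//= lebesgue_measure_itv /= lte_fin.
by move: ab; rewrite le_eqVlt => /predU1P[->|->//]; rewrite ltxx subrr mulr0.
Qed.

Lemma sint_le f k a b : a <= b -> {within `[a, b], continuous (f : R -> R^o)} ->
  (forall t, a <= t <= b -> f t <= k) -> sint f a b <= k * (b - a).
Proof.
move=> ab cf fk; rewrite -sint_cst//; apply: le_Rintegral => //.
- exact: sint_integrable.
- apply: (@sint_integrable (fun=> k)); apply: continuous_subspaceT => x; exact: cvg_cst.
Qed.

Lemma sint_ge f k a b : a <= b -> {within `[a, b], continuous (f : R -> R^o)} ->
  (forall t, a <= t <= b -> k <= f t) -> k * (b - a) <= sint f a b.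
Proof.
move=> ab cf fk; rewrite -sint_cst//; apply: le_Rintegral => //.
- apply: (@sint_integrable (fun=> k)); apply: continuous_subspaceT => x; exact: cvg_cst.
- exact: sint_integrable.
Qed.

Lemma sint_near f k e a b : a <= b ->
  {within `[a, b], continuous (f : R -> R^o)} ->
  (forall t, a <= t <= b -> `|f t - k| <= e) ->
  `|sint f a b - k * (b - a)| <= e * (b - a).
Proof.
move=> ab cf fk; rewrite ler_distl -mulrBl -mulrDl; apply/andP; split.
  by apply: sint_ge => // t /fk; rewrite ler_distl => /andP[].
by apply: sint_le => // t /fk; rewrite ler_distl => /andP[].
Qed.

End SegmentIntegral.

Section Goursat.
Variables (R : realType) (u v : R -> R -> R).
Implicit Types a b c d x y : R.

(** Complex differentiability of u + iv at x + iy, with derivative p + iq, in real coordinates and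
    without division. Nothing is asked of the derivative as a function of the point. *)
Definition cauchy_riemann x y := exists p q : R, forall e : R, 0 < e ->
  exists2 r : R, 0 < r & forall h k, `|h| < r -> `|k| < r ->
  `|u (x + h) (y + k) - u x y - (p * h - q * k)| <= e * (`|h| + `|k|) /\
  `|v (x + h) (y + k) - v x y - (q * h + p * k)| <= e * (`|h| + `|k|).

Lemma cauchy_riemann_cont x y : cauchy_riemann x y ->
  [/\ {for y, continuous (fun t => u x t : R^o)},
      {for x, continuous (fun t => u t y : R^o)},
      {for y, continuous (fun t => v x t : R^o)} &
      {for x, continuous (fun t => v t y : R^o)}].
Proof.
move=> [p [q H]].
suff K (e : R) : 0 < e -> exists2 r : R, 0 < r & forall h k, `|h| < r -> `|k| < r ->
    `|u (x + h) (y + k) - u x y| < e /\ `|v (x + h) (y + k) - v x y| < e.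
  split; apply/cvgrPdist_lt => e e0; have [r r0 Hr] := K e e0;
    apply/nbhs_ballP; exists r => // t; rewrite /ball /= => tr;
    rewrite distrC.
  - by have := Hr 0 (t - y); rewrite normr0 addr0 subrKC (distrC t y) tr => /(_ r0 isT)[].
  - by have := Hr (t - x) 0; rewrite normr0 addr0 subrKC (distrC t x) tr => /(_ isT r0)[].
  - by have := Hr 0 (t - y); rewrite normr0 addr0 subrKC (distrC t y) tr => /(_ r0 isT)[].
  - by have := Hr (t - x) 0; rewrite normr0 addr0 subrKC (distrC t x) tr => /(_ isT r0)[].
move=> e0; have [r r0 Hr] := H 1 ltr01.
pose M := `|p| + `|q| + 1.
have M0 : 0 < M by rewrite /M; have := normr_ge0 p; have := normr_ge0 q; lra.
exists (Num.min r (e / (3 * M))); first by rewrite lt_min r0 divr_gt0// mulr_gt0.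
move=> h k; rewrite !lt_min !ltr_pdivlMr ?mulr_gt0// => /andP[hr he] /andP[kr ke].
have [H1 H2] := Hr h k hr kr.
have B1 : `|p * h - q * k| <= M * `|h| + M * `|k| - `|h| - `|k|.
  rewrite (le_trans (ler_normB _ _))// !normrM /M.
  have := normr_ge0 h; have := normr_ge0 k; have := normr_ge0 p; have := normr_ge0 q; nra.
have B2 : `|q * h + p * k| <= M * `|h| + M * `|k| - `|h| - `|k|.
  rewrite (le_trans (ler_normD _ _))// !normrM /M.
  have := normr_ge0 h; have := normr_ge0 k; have := normr_ge0 p; have := normr_ge0 q; nra.
have T (s t : R) : `|s| <= `|s - t| + `|t|.
  by rewrite -{1}(subrK t s) ler_normD.
have := T (u (x + h) (y + k) - u x y) (p * h - q * k).
have := T (v (x + h) (y + k) - v x y) (q * h + p * k).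
split; nra.
Qed.

(** The imaginary part of the counterclockwise integral of (u + iv) dz around the rectangle. The
    real part can be ignored, because the integral of dz / z is purely imaginary. *)
Definition boundary_int a b c d : R :=
  sint (fun y => u b y - u a y) c d + sint (fun x => v x c - v x d) a b.

Definition CR_rect a b c d := forall x y, a <= x <= b -> c <= y <= d ->
  cauchy_riemann x y.

Lemma CR_rectW a b c d a' b' c' d' : a <= a' -> b' <= b -> c <= c' -> d' <= d ->
  CR_rect a b c d -> CR_rect a' b' c' d'.
Proof. by move=> aa bb cc dd H x y xx yy; apply: H; lra. Qed.

Lemma CR_rect_cont a b c d : CR_rect a b c d ->
  (forall x, a <= x <= b -> {within `[c, d], continuous (fun t => u x t : R^o)}) /\
  (forall y, c <= y <= d -> {within `[a, b], continuous (fun t => v t y : R^o)}).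
Proof.
move=> H; split => z zz; apply: continuous_in_subspaceT => t;
  rewrite inE /= in_itv /= => tt.
  by have [] := cauchy_riemann_cont (H _ _ zz tt).
by have [] := cauchy_riemann_cont (H _ _ tt zz).
Qed.

Lemma within_contB (f g : R -> R) (A : set R) :
  {within A, continuous (f : R -> R^o)} -> {within A, continuous (g : R -> R^o)} ->
  {within A, continuous (fun t => f t - g t : R^o)}.
Proof. by move=> cf cg x; apply: cvgB; [exact: cf | exact: cg]. Qed.

Lemma boundary_int_splitx m a b c d : a <= m -> m <= b -> c <= d ->
  (forall x, x = a \/ x = m \/ x = b ->
     {within `[c, d], continuous (fun t => u x t : R^o)}) ->
  (forall y, y = c \/ y = d ->
     {within `[a, b], continuous (fun t => v t y : R^o)}) ->
  boundary_int a b c d = boundary_int a m c d + boundary_int m b c d.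
Proof.
move=> am mb cd cu cv.
have ca := cu a (or_introl erefl); have cm := cu m (or_intror (or_introl erefl)).
have cb := cu b (or_intror (or_intror erefl)).
rewrite /boundary_int (sint_split am mb); last first.
  by apply: within_contB; apply: cv; [left|right].
rewrite (sintB cb ca) (sintB cm ca) (sintB cb cm); lra.
Qed.

Lemma boundary_int_splity m a b c d : c <= m -> m <= d -> a <= b ->
  (forall x, x = a \/ x = b ->
     {within `[c, d], continuous (fun t => u x t : R^o)}) ->
  (forall y, y = c \/ y = m \/ y = d ->
     {within `[a, b], continuous (fun t => v t y : R^o)}) ->
  boundary_int a b c d = boundary_int a b c m + boundary_int a b m d.
Proof.
move=> cm md ab cu cv.
have cc := cv c (or_introl erefl); have cvm := cv m (or_intror (or_introl erefl)).
have cd := cv d (or_intror (or_intror erefl)).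
rewrite /boundary_int (sint_split cm md); last first.
  by apply: within_contB; apply: cu; [right|left].
rewrite (sintB cc cd) (sintB cc cvm) (sintB cvm cd); lra.
Qed.

(** The affine part of the expansion contributes p (b - a) (d - c) from the vertical sides and its
    opposite from the horizontal ones; only the remainder is left. *)
Lemma boundary_int_local x y : cauchy_riemann x y -> forall e : R, 0 < e ->
  exists2 r : R, 0 < r & forall a b c d, a <= x <= b -> c <= y <= d ->
    b - a < r -> d - c < r -> CR_rect a b c d ->
    `|boundary_int a b c d| <= e * (b - a + (d - c)) ^+ 2.
Proof.
move=> [p [q H]] e e0; have [|r r0 Hr] := H (e / 2); first by rewrite divr_gt0.
exists r => // a b c d ax cy bar dcr cr.
have [cu cv] := CR_rect_cont cr.
have ab : a <= b by lra.
have cd : c <= d by lra.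
have K x' y' : a <= x' <= b -> c <= y' <= d ->
    `|u x' y' - u x y - (p * (x' - x) - q * (y' - y))| <= e / 2 * (b - a + (d - c)) /\
    `|v x' y' - v x y - (q * (x' - x) + p * (y' - y))| <= e / 2 * (b - a + (d - c)).
  move=> xx yy; have [||] := Hr (x' - x) (y' - y).
  - by rewrite ltr_norml; apply/andP; split; lra.
  - by rewrite ltr_norml; apply/andP; split; lra.
  rewrite !subrKC => H1 H2.
  have : e / 2 * (`|x' - x| + `|y' - y|) <= e / 2 * (b - a + (d - c)).
    apply: ler_wpM2l; first lra.
    by apply: lerD; rewrite ler_norml; apply/andP; split; lra.
  by split; lra.
have S1 : `|sint (fun y => u b y - u a y) c d - (p * (b - a)) * (d - c)| <=
    e * (b - a + (d - c)) * (d - c).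
  apply: sint_near => //; first by apply: within_contB; apply: cu; lra.
  move=> t tt; have [||+ _] := K b t; [lra|lra|].
  have [||+ _] := K a t; [lra|lra|].
  by rewrite !ler_norml => /andP[h1 h2] /andP[h3 h4]; apply/andP; split; lra.
have S2 : `|sint (fun x => v x c - v x d) a b - (p * (c - d)) * (b - a)| <=
    e * (b - a + (d - c)) * (b - a).
  apply: sint_near => //; first by apply: within_contB; apply: cv; lra.
  move=> t tt; have [||_ +] := K t c; [lra|lra|].
  have [||_ +] := K t d; [lra|lra|].
  by rewrite !ler_norml => /andP[h1 h2] /andP[h3 h4]; apply/andP; split; lra.
move: S1 S2; rewrite /boundary_int !ler_norml => /andP[h1 h2] /andP[h3 h4].
by apply/andP; split; rewrite expr2; lra.
Qed.

Let rect := ((R * R) * (R * R))%type.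
(** Rectangles whose boundary integral is large compared with their area. One of the four quarters
    always inherits this, since both quantities add up; differentiability at the limit point forbids
    it. *)
Let excess (e : R) (s : rect) :=
  [/\ s.1.1 <= s.1.2, s.2.1 <= s.2.2, CR_rect s.1.1 s.1.2 s.2.1 s.2.2 &
   e * ((s.1.2 - s.1.1) * (s.2.2 - s.2.1)) <
     `|boundary_int s.1.1 s.1.2 s.2.1 s.2.2|].
Let quarter (s t : rect) :=
  [/\ s.1.1 <= t.1.1, t.1.2 <= s.1.2, s.2.1 <= t.2.1 & t.2.2 <= s.2.2] /\
  t.1.2 - t.1.1 = (s.1.2 - s.1.1) / 2 /\ t.2.2 - t.2.1 = (s.2.2 - s.2.1) / 2.

Lemma excess_quarter e s : excess e s -> exists2 t, excess e t & quarter s t.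
Proof.
case: s => [[a b] [c d]]; rewrite /excess /= => -[ab cd cr ex].
pose m := (a + b) / 2; pose n := (c + d) / 2.
have ? : a <= m by rewrite /m; lra.
have ? : m <= b by rewrite /m; lra.
have ? : c <= n by rewrite /n; lra.
have ? : n <= d by rewrite /n; lra.
have [cu cv] := CR_rect_cont cr.
have E1 : boundary_int a b c d = boundary_int a m c d + boundary_int m b c d.
  apply: boundary_int_splitx => // z zz; first by apply: cu; lra.
  by apply: cv; lra.
have cr1 : CR_rect a m c d by apply: CR_rectW cr => //; lra.
have cr2 : CR_rect m b c d by apply: CR_rectW cr => //; lra.
have [cu1 cv1] := CR_rect_cont cr1.
have [cu2 cv2] := CR_rect_cont cr2.
have E2 : boundary_int a m c d = boundary_int a m c n + boundary_int a m n d.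
  apply: boundary_int_splity => // z zz; first by apply: cu1; lra.
  by apply: cv1; lra.
have E3 : boundary_int m b c d = boundary_int m b c n + boundary_int m b n d.
  apply: boundary_int_splity => // z zz; first by apply: cu2; lra.
  by apply: cv2; lra.
pose A := e * ((b - a) / 2 * ((d - c) / 2)).
have EA : e * ((b - a) * (d - c)) = A + A + A + A by rewrite /A; field.
have mm1 : m - a = (b - a) / 2 by rewrite /m; field.
have mm2 : b - m = (b - a) / 2 by rewrite /m; field.
have nn1 : n - c = (d - c) / 2 by rewrite /n; field.
have nn2 : d - n = (d - c) / 2 by rewrite /n; field.
have [l1|l1] := ltP A `|boundary_int a m c n|.
  exists ((a, m), (c, n)); split => //=; rewrite ?mm1 ?nn1//.
  by apply: CR_rectW cr.
have [l2|l2] := ltP A `|boundary_int a m n d|.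
  exists ((a, m), (n, d)); split => //=; rewrite ?mm1 ?nn2//.
  by apply: CR_rectW cr.
have [l3|l3] := ltP A `|boundary_int m b c n|.
  exists ((m, b), (c, n)); split => //=; rewrite ?mm2 ?nn1//.
  by apply: CR_rectW cr.
have [l4|l4] := ltP A `|boundary_int m b n d|.
  exists ((m, b), (n, d)); split => //=; rewrite ?mm2 ?nn2//.
  by apply: CR_rectW cr.
move: ex; rewrite EA E1 E2 E3 => ex.
have := ler_normD (boundary_int a m c n + boundary_int a m n d)
  (boundary_int m b c n + boundary_int m b n d).
have := ler_normD (boundary_int a m c n) (boundary_int a m n d).
have := ler_normD (boundary_int m b c n) (boundary_int m b n d).
lra.
Qed.

Lemma nested_point (s : nat -> R * R) :
  (forall n, (s n).1 <= (s n.+1).1 /\ (s n.+1).2 <= (s n).2) ->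
  (forall n, (s n).1 <= (s n).2) -> exists x, forall n, (s n).1 <= x <= (s n).2.
Proof.
move=> mono le.
have m1 n k : (s n).1 <= (s (n + k)%N).1.
  elim: k => [|k ih]; rewrite ?addn0// addnS (le_trans ih)//.
  by have [] := mono (n + k)%N.
have m2 n k : (s (n + k)%N).2 <= (s n).2.
  elim: k => [|k ih]; rewrite ?addn0// addnS (le_trans _ ih)//.
  by have [] := mono (n + k)%N.
have m3 n k : (s n).1 <= (s k).2.
  by rewrite (le_trans (m1 n k))// (le_trans (le _))// addnC m2.
pose A := range (fun n => (s n).1).
exists (sup A) => n; apply/andP; split.
  apply: ub_le_sup; last by exists n.
  by exists (s 0%N).2 => _ [k _ <-].
by apply: ge_sup; [exists (s 0%N).1, 0%N | move=> _ [k _ <-]].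
Qed.

Theorem goursat a b c d : a < b -> c < d -> CR_rect a b c d ->
  boundary_int a b c d = 0.
Proof.
move=> ab cd cr; apply/eqP; apply: contraT => nz.
set J := boundary_int a b c d in nz.
pose S := (b - a) * (d - c).
have S0 : 0 < S by rewrite mulr_gt0// subr_gt0.
pose e : R := `|J| / 2 / S.
have J0 : 0 < `|J| by rewrite normr_gt0.
have e0 : 0 < e by rewrite !divr_gt0.
have ex0 : excess e ((a, b), (c, d)).
  split => //=; try exact: ltW.
  by rewrite -/J -/S /e divfK ?gt_eqF//; lra.
have step (s : {s | excess e s}) : {t : {s | excess e s} | quarter (sval s) (sval t)}.
  apply: cid; have [t et qt] := excess_quarter (svalP s).
  by exists (exist _ t et).
pose s := fix s n : {s | excess e s} :=
  if n is k.+1 then sval (step (s k)) else exist _ _ ex0.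
have sq n : quarter (sval (s n)) (sval (s n.+1)) by exact: (svalP (step (s n))).
have sw n : (sval (s n)).1.2 - (sval (s n)).1.1 = (b - a) / 2 ^+ n /\
            (sval (s n)).2.2 - (sval (s n)).2.1 = (d - c) / 2 ^+ n.
  elim: n => [|n [ih1 ih2]]; first by rewrite expr0 !divr1.
  have [_ [-> ->]] := sq n; rewrite ih1 ih2 exprS.
  by split; field; rewrite expf_neq0.
have [x Hx] : exists x, forall n, (sval (s n)).1.1 <= x <= (sval (s n)).1.2.
  apply: (nested_point (s := fun n => (sval (s n)).1)) => n.
    by have [[]] := sq n.
  by have [] := svalP (s n).
have [y Hy] : exists x, forall n, (sval (s n)).2.1 <= x <= (sval (s n)).2.2.
  apply: (nested_point (s := fun n => (sval (s n)).2)) => n.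
    by have [[]] := sq n.
  by have [] := svalP (s n).
have crxy : cauchy_riemann x y by apply: cr; [exact: (Hx 0%N)|exact: (Hy 0%N)].
pose Q := (b - a + (d - c)) ^+ 2.
have Q0 : 0 < Q by rewrite exprn_gt0// addr_gt0 ?subr_gt0.
(* Bisection keeps the ratio of the area to the squared half-perimeter equal to [S / Q], so this
   local error is exactly [e] times the area. *)
have e'0 : 0 < e * S / Q by rewrite divr_gt0// mulr_gt0.
have [r r0 Hr] := boundary_int_local crxy e'0.
have [n nr] : exists n : nat, (b - a) / 2 ^+ n < r /\ (d - c) / 2 ^+ n < r.
  pose m := Num.truncn ((b - a + (d - c)) / r); exists m.+1.
  have h : (b - a + (d - c)) / r < 2 ^+ m.+1.
    apply: (lt_trans (truncnS_gt _)).
    by rewrite -natrX ltr_nat ltn_expl.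
  move: h; rewrite ltr_pdivrMr// => h.
  by split; rewrite ltr_pdivrMr ?exprn_gt0//; lra.
have [ab' cd' cr' ex'] := svalP (s n).
have [w1 w2] := sw n.
have := Hr _ _ _ _ (Hx n) (Hy n).
rewrite w1 w2 => /(_ nr.1 nr.2 cr'); move: ex'; rewrite w1 w2.
suff -> : e * S / Q * ((b - a) / 2 ^+ n + (d - c) / 2 ^+ n) ^+ 2 =
    e * ((b - a) / 2 ^+ n * ((d - c) / 2 ^+ n)).
  by move=> h1 h2; move: (lt_le_trans h1 h2); rewrite ltxx.
rewrite /Q /S; field.
by rewrite expf_neq0//= gt_eqF// addr_gt0 ?subr_gt0.
Qed.

End Goursat.

(** * Complex derivatives and the Cauchy-Riemann expansion *)

Section ComplexDerivative.
Variable R : realType.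
Implicit Types (f g : Cx R -> Cx R) (z w l : Cx R).
Local Notation Re := complex.Re.
Local Notation Im := complex.Im.

Lemma derivable_nmP g z : derivable g z 1 <->
  exists l, forall e : R, 0 < e -> exists2 r : R, 0 < r &
    forall w, nm (w - z) < r -> nm (g w - g z - l * (w - z)) <= e * nm (w - z).
Proof.
split=> [dg|[l Hl]].
  exists ('D_1 g z) => e e0.
  have /cvg_nmP /(_ _ e0) : h^-1 *: ((g \o shift z) (h *: 1) - g z) @[h --> 0^'] --> 'D_1 g z.
    exact: dg.
  move=> H; have [r r0 Hr] := (nbhs_nmP (0 : Cx R) [set h | h != 0 ->
    nm (h^-1 *: (g (h *: 1 + z) - g z) - 'D_1 g z) < e]).1 H.
  exists r => // w wz.
  have [->|wz0] := eqVneq w z; first by rewrite !subrr mulr0 subr0 nm0 mulr0.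
  have wz1 : w - z != 0 by rewrite subr_eq0.
  have := Hr (w - z); rewrite subr0 => /(_ wz wz1).
  rewrite /= [(w - z) *: 1]mulr1 subrK => {}H.
  have {}H : nm ((w - z)^-1 * (g w - g z) - 'D_1 g z) < e := H.
  have -> : g w - g z - 'D_1 g z * (w - z) = (w - z) * ((w - z)^-1 * (g w - g z) - 'D_1 g z).
    by rewrite [RHS]mulrBr mulrA mulfV// mul1r [X in _ = _ - X]mulrC.
  by rewrite nmM mulrC ler_wpM2r ?nm_ge0 ?ltW.
apply/cvg_ex; exists l; apply/cvg_nmP => e e0.
have [|r r0 Hr] := Hl (e / 2); first by rewrite divr_gt0.
apply: (nbhs_nmP (0 : Cx R) [set h | h != 0 ->
  nm (h^-1 *: (g (h *: 1 + z) - g z) - l) < e]).2; exists r => // h.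
rewrite subr0 => hr h0 /=; have := Hr (h + z); rewrite addrK => /(_ hr) H.
have -> : h^-1 *: (g (h *: 1 + z) - g z) - l = h^-1 * (g (h + z) - g z - l * h).
  by rewrite /GRing.scale /= mulr1 [in RHS]mulrBr [X in _ = _ - X]mulrCA mulVf// mulr1.
rewrite nmM nmV; have h1 : 0 < nm h by rewrite nm_gt0.
rewrite mulrC ltr_pdivrMr// (le_lt_trans H)// ltr_pM2r//.
by rewrite ltr_pdivrMr//; lra.
Qed.

Lemma derivable_continuous g z : derivable g z 1 -> {for z, continuous g}.
Proof. by move=> /derivable1_diffP /differentiable_continuous. Qed.

Lemma derivable_exp g n z : derivable g z 1 -> derivable (fun w => g w ^+ n) z 1.
Proof.
move=> dg; rewrite (_ : (fun w => g w ^+ n) = g ^+ n); first exact: derivableX.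
by apply/funext => w; rewrite exprfctE.
Qed.

Lemma derivable_translate g a z :
  derivable g (a + z) 1 -> derivable (fun w => g (a + w)) z 1.
Proof.
move=> /derivable_nmP[l Hl]; apply/derivable_nmP; exists l => e e0.
have [r r0 Hr] := Hl e e0; exists r => // w wz.
have E : a + w - (a + z) = w - z by rewrite opprD addrACA subrr add0r.
by have := Hr (a + w); rewrite E; apply.
Qed.

Lemma derivable_cauchy_riemann g (x y : R) :
  derivable g (x +i* y)%C 1 ->
  cauchy_riemann (fun s t => Re (g (s +i* t)%C)) (fun s t => Im (g (s +i* t)%C)) x y.
Proof.
move=> /derivable_nmP[l Hl]; exists (Re l), (Im l) => e e0.
have [r r0 Hr] := Hl e e0; exists (r / 2); first by rewrite divr_gt0.
move=> h k hr kr.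
have E : ((x + h) +i* (y + k))%C - (x +i* y)%C = (h +i* k)%C :> Cx R.
  by apply: eqC; rewrite !ReImE /=; lra.
have N : nm (h +i* k : Cx R)%C <= `|h| + `|k| by exact: (@le_nm_ReIm R (h +i* k)%C).
have hkr : nm (h +i* k : Cx R)%C < r by lra.
have := Hr ((x + h) +i* (y + k))%C; rewrite E => /(_ hkr) H.
have {}H := le_trans H (ler_wpM2l (ltW e0) N).
split; apply: (le_trans _ H).
  by apply: le_trans (le_Re_nm _); rewrite !ReImE /=.
apply: le_trans (le_Im_nm _); rewrite !ReImE /=.
by rewrite [Im l * h + _]addrC.
Qed.

End ComplexDerivative.

(** * Goursat's theorem around an isolated singularity *)

Section PuncturedSquare.
Variables (R : realType) (u v : R -> R -> R) (r : R).
Hypothesis crq : forall s t, `|s| <= r -> `|t| <= r -> s != 0 \/ t != 0 ->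
  cauchy_riemann u v s t.

Lemma punctured_slices z : `|z| <= r -> z != 0 ->
  {within `[-r, r], continuous (fun t => u z t : R^o)} /\
  {within `[-r, r], continuous (fun t => v t z : R^o)}.
Proof.
move=> zr z0; split; apply: continuous_in_subspaceT => t;
  rewrite inE /= in_itv /= -ler_norml => tr.
  by have [] := cauchy_riemann_cont (crq zr tr (or_introl z0)).
by have [] := cauchy_riemann_cont (crq tr zr (or_intror z0)).
Qed.

Lemma goursat_away a b c d : a < b -> c < d -> - r <= a -> b <= r -> - r <= c ->
  d <= r -> 0 < a \/ b < 0 \/ 0 < c \/ d < 0 -> boundary_int u v a b c d = 0.
Proof.
move=> ab cd ra rb rc rd away; apply: goursat => // s t /andP[a1 a2] /andP[a3 a4].
apply: crq.
- by rewrite ler_norml (le_trans ra)// (le_trans a2).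
- by rewrite ler_norml (le_trans rc)// (le_trans a4).
- case: away => [a0|[b0|[c0|d0]]]; [left|left|right|right].
  + by rewrite gt_eqF// (lt_le_trans a0).
  + by rewrite lt_eqF// (le_lt_trans _ b0).
  + by rewrite gt_eqF// (lt_le_trans c0).
  + by rewrite lt_eqF// (le_lt_trans _ d0).
Qed.

(* Goursat on the four rectangles surrounding the small square. *)
Lemma boundary_int_puncture e : 0 < e -> e < r ->
  boundary_int u v (- r) r (- r) r = boundary_int u v (- e) e (- e) e.
Proof.
move=> e0 er.
have r0 : 0 < r by rewrite (lt_trans e0).
have o1 : - r < - e by rewrite ltrN2.
have o2 : - e < e by rewrite gtrN.
have o3 : - r < r by rewrite gtrN.
have ne0 : - e < 0 by rewrite oppr_lt0.
have o4 : - e < r by rewrite (lt_trans o2).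
have [l1 l2 l3 l4 l5] : [/\ - r <= - e, - e <= e, - r <= r, e <= r & - e <= r] by split; exact: ltW.
have l6 : - r <= e by rewrite ltW// (lt_trans o1).
have S z : z = e \/ z = - e \/ z = r \/ z = - r ->
    {within `[-r, r], continuous (fun t => u z t : R^o)} /\
    {within `[-r, r], continuous (fun t => v t z : R^o)}.
  by move=> [->|[->|[->|->]]]; apply: punctured_slices;
    rewrite ?normrN ?oppr_eq0 ?gtr0_norm// gt_eqF.
have [[ue ve] [une vne]] := (S e (or_introl erefl), S (- e) (or_intror (or_introl erefl))).
have [ur vr] := S r (or_intror (or_intror (or_introl erefl))).
have [unr vnr] := S (- r) (or_intror (or_intror (or_intror erefl))).
have sub (f : R -> R^o) a b : - r <= a -> b <= r -> {within `[-r, r], continuous f} ->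
    {within `[a, b], continuous f}.
  move=> ar br; apply: continuous_subspaceW => x /=; rewrite !in_itv /= => /andP[ax xb].
  by rewrite (le_trans ar)// (le_trans xb).
rewrite (boundary_int_splitx l1 l5 l3); last 2 first.
- by move=> x [->|[->|->]].
- by move=> x [->|->].
rewrite goursat_away ?add0r//; last by right; left.
rewrite (boundary_int_splitx l2 l4 l3); last 2 first.
- by move=> x [->|[->|->]].
- by move=> x [->|->]; apply: sub.
rewrite (@goursat_away e r) ?addr0//; last by left.
rewrite (boundary_int_splity l1 l5 l2); last 2 first.
- by move=> x [->|->].
- by move=> x [->|[->|->]]; apply: sub.
rewrite (@goursat_away (- e) e (- r)) ?add0r//; last by do 3 right.
rewrite (boundary_int_splity l2 l4 l2); last 2 first.
- by move=> x [->|->]; apply: sub.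
- by move=> x [->|[->|->]]; apply: sub.
by rewrite (@goursat_away (- e) e e) ?addr0//; right; right; left.
Qed.

End PuncturedSquare.

(** * Maximum modulus and Schwarz-Pick *)

Section MaximumModulus.
Variable R : realType.
Implicit Types (F : Cx R -> Cx R) (z w : Cx R).
Local Notation Re := complex.Re.
Local Notation Im := complex.Im.

Lemma ReV z : Re z^-1 = Re z / (nm z) ^+ 2.
Proof. by rewrite nm_sqr; case: z. Qed.

Definition on_square (r : R) w :=
  [/\ `|Re w| <= r, `|Im w| <= r & `|Re w| = r \/ `|Im w| = r].

(** On the side Re w = r of the square, 1 / w has real part at least 1 / (2 r), and f / w has
    modulus at most 1 / (4 r). The other sides are rotated onto this one. *)
Lemma Re_quotient_ge (r : R) (f w : Cx R) : 0 < r -> Re w = r -> `|Im w| <= r ->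
  nm f <= 1 / 4 -> 1 / (4 * r) <= Re ((1 - f) / w).
Proof.
move=> r0 wr wi fb; rewrite mulrBl [1 / w]mul1r ReD ReN.
have nw : r <= nm w by rewrite -wr (le_trans (ler_norm _)) ?le_Re_nm.
have n0 : 0 < nm w by lra.
have h1 : 1 / (2 * r) <= Re w^-1.
  rewrite ReV nm_sqr wr ler_pdivlMr ?ltr_wpDr ?sqr_ge0 ?exprn_gt0//.
  rewrite mulrC mulrA mulr1 ler_pdivrMr ?mulr_gt0//.
  have : Im w ^+ 2 <= r ^+ 2.
    by rewrite -(real_normK (num_real (Im w))) ler_pXn2r// nnegrE// ltW.
  rewrite !expr2; nra.
have h2 : Re (f / w) <= 1 / (4 * r).
  apply: le_trans (ler_norm _) (le_trans (le_Re_nm _) _).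
  rewrite nmM nmV ler_pdivrMr// (le_trans fb)//.
  rewrite -(ler_pM2r r0); have -> : 1 / (4 * r) * nm w * r = nm w / 4 by field; lra.
  lra.
have -> : 1 / (4 * r) = 1 / (2 * r) - 1 / (4 * r) by field; lra.
lra.
Qed.

(** If |F| <= 1/4 on the square, each pair of opposite sides contributes at least 1 to the integral
    of q = (1 - F) / w, so at least 2 in all. As F is differentiable with F(z0) = 1, q is bounded by
    some [B] near 0, and a small square of half-side [e] gives at most 8 B e. *)
Lemma square_quarter F z0 (r : R) : 0 < r ->
  (forall w, `|Re w| <= r -> `|Im w| <= r -> derivable F (z0 + w) 1) ->
  F z0 = 1 -> exists2 w, on_square r w & 1 / 4 < nm (F (z0 + w)).
Proof.
move=> r0 dF F1; apply: contrapT => nex.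
have bF w : on_square r w -> nm (F (z0 + w)) <= 1 / 4.
  by move=> ow; rewrite leNgt; apply/negP => lt; apply: nex; exists w.
pose q w := (1 - F (z0 + w)) / w.
pose u s t := Re (q (s +i* t)%C); pose v s t := Im (q (s +i* t)%C).
have dq w : `|Re w| <= r -> `|Im w| <= r -> w != 0 -> derivable q w 1.
  move=> rw iw w0; apply: derivableM; last by apply: derivableV.
  by apply: derivableB => //; exact/derivable_translate/dF.
have crq s t : `|s| <= r -> `|t| <= r -> s != 0 \/ t != 0 -> cauchy_riemann u v s t.
  move=> sr tr st; apply: derivable_cauchy_riemann; apply: dq => //.
  by rewrite eq_complex /= negb_and; apply/orP.
have cu s : `|s| <= r -> s != 0 ->
    {within `[-r, r], continuous (fun t => u s t : R^o)}.
  by move=> sr s0; exact: (punctured_slices crq sr s0).1.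
have cv t : `|t| <= r -> t != 0 ->
    {within `[-r, r], continuous (fun s => v s t : R^o)}.
  by move=> tr t0; exact: (punctured_slices crq tr t0).2.
have sub (f : R -> R^o) (a b : R) : - r <= a -> b <= r -> {within `[-r, r], continuous f} ->
    {within `[a, b], continuous f}.
  move=> ar br; apply: continuous_subspaceW => x /=; rewrite !in_itv /= => ?.
  by apply/andP; split; lra.
have nr : `|r| = r by rewrite gtr0_norm.
have rn0 : r != 0 by rewrite gt_eqF.
have nrn0 : - r != 0 by rewrite oppr_eq0.
(* On the large square the four integrands have a definite sign. *)
have big : 2 <= boundary_int u v (- r) r (- r) r.
  have rr : - r <= r by lra.
  have E : 1 / (4 * r) + 1 / (4 * r) = 1 / (2 * r) by field.
  have E1 : 1 = 1 / (2 * r) * (r - - r) by field.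
  have bF' s t : `|s| <= r -> `|t| <= r -> `|s| = r \/ `|t| = r ->
      nm (F (z0 + (s +i* t)%C)) <= 1 / 4.
    by move=> ? ? ?; apply: bF; split.
  have -> : 2 = 1 + 1 :> R by lra.
  apply: lerD; rewrite {1}E1; apply: sint_ge => //.
  - by apply: within_contB; apply: cu; rewrite ?normrN ?nr.
  - move=> t; rewrite -ler_norml => tr; rewrite -E; apply: lerD.
      by apply: Re_quotient_ge => //=; apply: bF'; rewrite ?nr//; left.
    rewrite /u /q -ReN -mulrN -invrN; apply: Re_quotient_ge => //=.
    + by rewrite opprK.
    + by rewrite normrN.
    + by apply: bF'; rewrite ?normrN ?nr//; left.
  - by apply: within_contB; apply: cv; rewrite ?normrN ?nr.
  - move=> s; rewrite -ler_norml => sr; rewrite -E; apply: lerD.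
      (* Multiplication by i carries the bottom side to the right one, and Im q = Re (q / i); for
         the top side the multiplier is -i. *)
      have -> : v s (- r) = Re ((1 - F (z0 + (s +i* (- r))%C)) / (('i)%C * (s +i* (- r))%C)).
        rewrite invfM mulrCA mulrC -/(q _) /v.
        have -> : ('i)%C^-1 = - ('i)%C :> Cx R.
          by apply: (mulfI (@neq0Ci (Cx R))); rewrite mulfV ?neq0Ci// mulrN -expr2 sqr_i opprK.
        by rewrite ReM !ReImE /=; lra.
      apply: Re_quotient_ge => //=; first by rewrite ?ReM /=; lra.
        by rewrite mul0r add0r mul1r.
      by apply: bF'; rewrite ?normrN ?nr//; right.
    have -> : - v s r = Re ((1 - F (z0 + (s +i* r)%C)) / (- (('i)%C * (s +i* r)%C))).
      rewrite invrN invfM mulrN mulrCA mulrC -/(q _) /v.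
      have -> : ('i)%C^-1 = - ('i)%C :> Cx R.
        by apply: (mulfI (@neq0Ci (Cx R))); rewrite mulfV ?neq0Ci// mulrN -expr2 sqr_i opprK.
      by rewrite mulrN opprK ReM !ReImE /=; lra.
    apply: Re_quotient_ge => //=; first by rewrite ?ReImE /=; lra.
      by rewrite normrN mul0r add0r mul1r.
    by apply: bF'; rewrite ?normrN ?nr//; right.
have [B [d [d0 B0 Hd]]] : exists B d : R, [/\ 0 < d, 0 < B &
    forall w, w != 0 -> nm w < d -> nm (q w) <= B].
  have : derivable F (z0 + 0) 1 by apply: dF; rewrite /= normr0 ltW.
  rewrite addr0 => /derivable_nmP[l /(_ 1 ltr01)[d d0 Hd]].
  exists (nm l + 1), d; split => //; first by have := nm_ge0 l; lra.
  move=> w w0 wd; rewrite /q nmM nmV ler_pdivrMr ?nm_gt0//.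
  have := Hd (z0 + w); rewrite addrAC subrr add0r => /(_ wd); rewrite F1 mul1r => H.
  rewrite nm_distC; have := nmD (F (z0 + w) - 1 - l * w) (l * w).
  by rewrite subrK nmM; lra.
pose e := Num.min (r / 2) (Num.min (d / 4) (1 / (8 * B))).
have e0 : 0 < e by rewrite /e !lt_min !divr_gt0 ?mulr_gt0.
have [er ed eB] : [/\ e <= r / 2, e <= d / 4 & e <= 1 / (8 * B)].
  by split; rewrite /e ?ge_min ?lexx ?orbT.
have ee : - e <= e by lra.
have ne : `|e| = e by rewrite gtr0_norm.
have qB s t : `|s| <= e -> `|t| <= e -> s != 0 \/ t != 0 ->
    `|u s t| <= B /\ `|v s t| <= B.
  move=> se te st.
  have H : nm (q (s +i* t)%C) <= B.
    apply: Hd; first by rewrite eq_complex /= negb_and; apply/orP.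
    by have := le_nm_ReIm (s +i* t : Cx R)%C; rewrite /=; lra.
  by split; [have := le_Re_nm (q (s +i* t)%C) | have := le_Im_nm (q (s +i* t)%C)];
    rewrite /u /v; lra.
have le_e : `|e| <= e by rewrite ne.
have le_ne : `|- e| <= e by rewrite normrN ne.
have en0 : e != 0 by rewrite gt_eqF.
have nen0 : - e != 0 by rewrite oppr_eq0.
have er' : e <= r by lra.
have er1 : `|e| <= r by rewrite ne.
have er2 : `|- e| <= r by rewrite normrN ne.
have nrne : - r <= - e by rewrite lerN2.
have small : boundary_int u v (- e) e (- e) e <= 2 * B * (e - - e) + 2 * B * (e - - e).
  apply: lerD; apply: sint_le => //.
  - by apply: sub => //; apply: within_contB; apply: cu.
  - move=> t; rewrite -ler_norml => te.
    have := (qB e t le_e te (or_introl en0)).1.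
    have := (qB (- e) t le_ne te (or_introl nen0)).1.
    by rewrite !ler_norml => /andP[h1 _] /andP[_ h2]; lra.
  - by apply: sub => //; apply: within_contB; apply: cv.
  - move=> t; rewrite -ler_norml => te.
    have := (qB t e te le_e (or_intror en0)).2.
    have := (qB t (- e) te le_ne (or_intror nen0)).2.
    by rewrite !ler_norml => /andP[_ h1] /andP[h2 _]; lra.
have := big; rewrite (boundary_int_puncture (e := e) crq)//; last by lra.
move: eB; rewrite ler_pdivlMr ?mulr_gt0//; lra.
Qed.

Lemma expr_unbounded (x M : R) : 1 < x -> exists n : nat, M < x ^+ n.
Proof.
move=> x1; pose n := (Num.truncn (`|M| / (x - 1))).+1; exists n.
have h : `|M| / (x - 1) < n%:R by exact: truncnS_gt.
rewrite ltr_pdivrMr in h; last by lra.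
have B k : 1 + k%:R * (x - 1) <= x ^+ k.
  elim: k => [|k ih]; first by rewrite expr0 mul0r addr0.
  rewrite exprS -[k.+1]addn1 natrD; have k0 : 0 <= k%:R :> R by [].
  have := ler_wpM2l (ltW (lt_trans ltr01 x1)) ih.
  have : 0 <= k%:R * ((x - 1) * (x - 1)) by rewrite mulr_ge0// -expr2 sqr_ge0.
  lra.
by have := B n; have := ler_norm M; lra.
Qed.

(** The bound 1/4 is applied to (F / F(z0))^n with k^n < 1/16 = (1/4)^2. Squared moduli avoid square
    roots later on. *)
Lemma square_max F z0 (r k : R) : 0 < r -> 0 <= k -> k < 1 ->
  (forall w, `|Re w| <= r -> `|Im w| <= r -> derivable F (z0 + w) 1) ->
  F z0 != 0 ->
  exists2 w, on_square r w & k * nm (F z0) ^+ 2 < nm (F (z0 + w)) ^+ 2.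
Proof.
move=> r0 k0 k1 dF F0; apply: contrapT => nex.
have bF w : on_square r w -> nm (F (z0 + w)) ^+ 2 <= k * nm (F z0) ^+ 2.
  by move=> ow; rewrite leNgt; apply/negP => lt; apply: nex; exists w.
have [n Hn] : exists n, k ^+ n < 1 / 16.
  have [->|kn0] := eqVneq k 0; first by exists 1%N; rewrite expr1; lra.
  have kp : 0 < k by rewrite lt_def kn0.
  have [|n Hn] := @expr_unbounded k^-1 16; first by rewrite invf_gt1.
  exists n; move: Hn; rewrite exprVn => Hn.
  by rewrite -[X in X < _]invrK mul1r ltf_pV2 // posrE ?invr_gt0 ?exprn_gt0.
have [| | w ow] := @square_quarter (fun z => (F z / F z0) ^+ n) z0 r r0.
- move=> w rw iw; apply: (@derivable_exp _ (fun z => F z / F z0)).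
  by apply: (@derivableM _ _ F (fun=> (F z0)^-1)) => //; exact: dF.
- by rewrite divff// expr1n.
- apply/negP; rewrite -leNgt nmX nmM nmV.
  have p0 : 0 < nm (F z0) by rewrite nm_gt0.
  rewrite -(ler_pXn2r (n := 2)) ?nnegrE ?exprn_ge0 ?divr_ge0 ?nm_ge0//.
  rewrite -exprM mulnC exprM.
  have : (nm (F (z0 + w)) / nm (F z0)) ^+ 2 <= k.
    by rewrite expr_div_n ler_pdivrMr ?exprn_gt0// bF.
  move=> h; have := lerXn2r n _ _ h.
  rewrite !nnegrE sqr_ge0 k0 => /(_ isT isT) h'.
  by rewrite (le_trans h')// (le_trans (ltW Hn))//; lra.
Qed.

Lemma continuous_complex :
  continuous (fun p : R^o * R^o => (p.1 +i* p.2)%C : Cx R).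
Proof.
move=> [x y]; apply/cvg_nmP => e e0.
have e2 : 0 < e / 2 by rewrite divr_gt0.
exists (ball x (e / 2), ball y (e / 2)); first by split; exact: nbhsx_ballx.
move=> [s t] [/= xs yt].
apply: le_lt_trans (le_nm_ReIm _) _; rewrite !ReImE /=.
move: xs yt; rewrite /ball /= => xs yt.
by rewrite distrC [X in _ + X]distrC; lra.
Qed.

Lemma compact_disc (r : R) : compact [set z : Cx R | nm z <= r].
Proof.
have K : compact ((fun p : R^o * R^o => (p.1 +i* p.2)%C : Cx R) @` (`[-r, r] `*` `[-r, r])).
  apply: continuous_compact.
    by apply: continuous_subspaceT => p; exact: continuous_complex.
  by apply: compact_setX; exact: segment_compact.
apply: subclosed_compact K _.
  apply/closed_nmP => v h; rewrite /= leNgt; apply/negP => lt.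
  have [|u /= ur uv] := h (nm v - r); first by rewrite subr_gt0.
  by have := nmBB v u; rewrite nm_distC ler_norml => /andP[]; lra.
move=> z /= zr; exists (Re z, Im z); last by case: z {zr}.
split; rewrite /= in_itv /= -ler_norml.
  by rewrite (le_trans (le_Re_nm _)).
by rewrite (le_trans (le_Im_nm _)).
Qed.

(* Adding [ep * nm z ^+ 2] makes the maximum of [Phi] an interior point [z1]; the linear
   factor [p] compensates the first-order variation of this term around [z1], so
   that [F * p] has a strict maximum at [z1] among small squares. *)
Theorem max_modulus F (r B : R) : 0 < r ->
  (forall z, nm z <= r -> derivable F z 1) ->
  (forall z, nm z = r -> nm (F z) <= B) ->
  forall z, nm z <= r -> nm (F z) <= B.
Proof.
move=> r0 dF bF z0 z0r; rewrite leNgt; apply/negP => lt.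
have B0 : 0 <= B.
  by apply: le_trans (bF (r%:C)%C _); rewrite ?nm_ge0 ?nm_real ?gtr0_norm.
pose A := nm (F z0) ^+ 2 - B ^+ 2.
have A0 : 0 < A by rewrite subr_gt0 ltr_pXn2r// nnegrE nm_ge0.
(* On the disc the perturbation is at most A / 20: too small to move the maximum of [Phi] to the
   circle, and it leaves M >= 19 A / 20. *)
pose ep := A / (20 * r ^+ 2).
have ep0 : 0 < ep by rewrite divr_gt0// mulr_gt0// exprn_gt0.
have epr : ep * r ^+ 2 = A / 20 by rewrite /ep; field; lra.
pose Phi z := nm (F z) ^+ 2 + ep * nm z ^+ 2.
have [z1 z1r max1] : exists2 c, c \in [set z : Cx R | nm z <= r] &
    forall t, t \in [set z : Cx R | nm z <= r] -> Phi t <= Phi c.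
  apply: compact_EVT_max; [by exists z0 | exact: compact_disc|].
  apply: continuous_in_subspaceT => z; rewrite inE /= => zr.
  have cF : {for z, continuous (fun w => nm (F w) : R^o)}.
    apply: continuous_comp; last exact: continuous_nm.
    exact/derivable_continuous/dF.
  have cn : {for z, continuous (fun w : Cx R => nm w : R^o)} by exact: continuous_nm.
  have c1 : {for z, continuous (fun w => nm (F w) ^+ 2 : R^o)}.
    apply: (@continuous_comp _ _ _ (fun w => nm (F w) : R^o) (fun x : R^o => x ^+ 2)) => //.
    exact: exprn_continuous.
  have c2 : {for z, continuous (fun w : Cx R => nm w ^+ 2 : R^o)}.
    apply: (@continuous_comp _ _ _ (fun w : Cx R => nm w : R^o) (fun x : R^o => x ^+ 2)) => //.
    exact: exprn_continuous.
  have cP := cvgD c1 (cvgM (cvg_cst (ep : R^o)) c2); exact: cP.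
move: z1r; rewrite inE /= => z1r.
have {}max1 z : nm z <= r -> Phi z <= Phi z1 by move=> zr; apply: max1; rewrite inE.
have n2 z : nm z <= r -> nm z ^+ 2 <= r ^+ 2.
  by move=> zr; rewrite ler_pXn2r// nnegrE ?nm_ge0// ltW.
have P0 := max1 z0 z0r.
have z1lt : nm z1 < r.
  rewrite lt_neqAle z1r andbT; apply/eqP => z1e.
  have := bF z1 z1e; rewrite -(ler_pXn2r (n := 2)) ?nnegrE ?nm_ge0// => h.
  move: P0; rewrite /Phi z1e epr; have := mulr_ge0 (ltW ep0) (sqr_ge0 (nm z0)).
  rewrite /A; rewrite /A in A0; lra.
pose M := nm (F z1) ^+ 2.
have MA : 19 / 20 * A <= M.
  have := ler_wpM2l (ltW ep0) (n2 _ z1r); rewrite epr => h.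
  have := mulr_ge0 (ltW ep0) (sqr_ge0 (nm z0)); move: P0; rewrite /Phi -/M.
  have := sqr_ge0 B; rewrite /A in h *; lra.
have M0 : 0 < M by lra.
have F0 : F z1 != 0 by rewrite -nm_gt0 lt_def nm_ge0 andbT -sqrf_eq0 gt_eqF.
pose e := ep / M.
have e0 : 0 < e by rewrite divr_gt0.
(* The ratio of the two bounds, A / 20 over 19 A / 20. *)
have er : e * r ^+ 2 <= 1 / 19.
  rewrite /e mulrAC epr ler_pdivrMr//; lra.
pose s := (r - nm z1) / 2.
have s0 : 0 < s by rewrite divr_gt0// subr_gt0.
have inside w : `|Re w| <= s -> `|Im w| <= s -> nm (z1 + w) <= r.
  move=> h1 h2; have := nmD z1 w; have := le_nm_ReIm w; rewrite /s in h1 h2; lra.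
pose p z : Cx R := 1 + (e%:C%C : Cx R) * z1^* * (z - z1).
have ks : e * s ^+ 2 / 2 < 1.
  have : s ^+ 2 <= r ^+ 2.
    by rewrite ler_pXn2r ?nnegrE ?ltW// /s; have := nm_ge0 z1; lra.
  by move=> /(ler_wpM2l (ltW e0)); lra.
have [||| | w ow] := @square_max (fun z => F z * p z) z1 s (1 - e * s ^+ 2 / 2) s0.
- by lra.
- have := mulr_gt0 e0 (exprn_gt0 2 s0); lra.
- move=> w rw iw; apply: derivableM; first by apply: dF; exact: inside.
  by apply: derivableD => //; apply: derivableM => //.
- by rewrite mulf_neq0// /p subrr mulr0 addr0 oner_neq0.
apply/negP; rewrite -leNgt /p subrr mulr0 addr0 mulr1 addrAC subrr add0r nmM -/M.
have [rw iw bd] := ow.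
pose om : Cx R := (e%:C%C : Cx R) * z1^* * w; rewrite -/om; pose zz := nm w ^+ 2.
have ssz : s ^+ 2 <= zz.
  have sw : s <= nm w.
    by case: bd => [bd|bd]; [have := le_Re_nm w | have := le_Im_nm w]; rewrite bd.
  by rewrite /zz ler_pXn2r ?nnegrE ?nm_ge0// ltW.
have z1w := inside w rw iw.
have reomE : Re om = e * (Re z1 * Re w + Im z1 * Im w).
  by rewrite /om !ReImE /=; ring.
have H1 : nm (F (z1 + w)) ^+ 2 <= M * (1 - 2 * Re om - e * zz).
  have := max1 _ z1w; rewrite /Phi -/M => H.
  have E1 : nm (z1 + w) ^+ 2 = nm z1 ^+ 2 + 2 * (Re z1 * Re w + Im z1 * Im w) + zz.
    by rewrite /zz !nm_sqr !ReImE; ring.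
  rewrite E1 in H.
  have -> : M * (1 - 2 * Re om - e * zz) =
      M - ep * (2 * (Re z1 * Re w + Im z1 * Im w)) - ep * zz.
    by rewrite reomE /e; field; lra.
  lra.
have nom : nm om = e * nm z1 * nm w.
  by rewrite /om !nmM nmJ nm_real gtr0_norm.
have wr : nm w <= r.
  have := le_nm_ReIm w; have := nm_ge0 z1; rewrite /s in rw iw; lra.
have om1 : nm om <= 1 / 19.
  rewrite nom -mulrA (le_trans _ er)// ler_wpM2l ?(ltW e0)// expr2.
  by apply: ler_pM; rewrite ?nm_ge0.
have om2 : nm om ^+ 2 <= e * zz / 19.
  have -> : nm om ^+ 2 = (e * nm z1 ^+ 2) * (e * zz) by rewrite nom /zz; ring.
  have h : e * nm z1 ^+ 2 <= 1 / 19 by rewrite (le_trans _ er)// ler_wpM2l ?n2// ltW.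
  have ez : 0 <= e * zz by apply: mulr_ge0; [exact: ltW | exact: sqr_ge0].
  by have := ler_wpM2r ez h; lra.
have reom : `|Re om| <= 1 / 19 by rewrite (le_trans (le_Re_nm _)).
have H2 : nm (1 + om) ^+ 2 = 1 + 2 * Re om + nm om ^+ 2.
  by rewrite !nm_sqr !ReImE /=; ring.
rewrite exprMn H2.
apply: le_trans (ler_wpM2r _ H1) _; first by rewrite -H2 sqr_ge0.
have ez : 0 <= e * zz by apply: mulr_ge0; [exact: ltW | exact: sqr_ge0].
have es : e * s ^+ 2 <= e * zz by rewrite ler_wpM2l// ltW.
have no : 0 <= nm om ^+ 2 by exact: sqr_ge0.
move: reom; rewrite ler_norml => /andP[ro1 ro2].
(* The first-order terms [2 * Re om] cancel. What remains of second order beside [- e * zz] is a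
   small fraction of [e * zz], by the bounds with 1 / 19, and [zz] is at least [s ^+ 2] on the
   square. *)
have key : (1 - 2 * Re om - e * zz) * (1 + 2 * Re om + nm om ^+ 2) <= 1 - e * s ^+ 2 / 2.
  have p1 : 0 <= (Re om + 1 / 19) * (e * zz) by rewrite mulr_ge0//; lra.
  have p2 : 0 <= (Re om + 1 / 19) * nm om ^+ 2 by rewrite mulr_ge0//; lra.
  have p3 : 0 <= e * zz * nm om ^+ 2 by rewrite mulr_ge0.
  have p4 : 0 <= Re om ^+ 2 by exact: sqr_ge0.
  lra.
by have := ler_wpM2l (ltW M0) key; lra.
Qed.

End MaximumModulus.

(** * Schwarz-Pick for maps of the disc into the right half-plane *)

Section SchwarzPick.
Variable R : realType.
Implicit Types (z w u : Cx R).
Local Notation Re := complex.Re.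
Local Notation Im := complex.Im.

Lemma nm_div z w : nm (z / w) = nm z / nm w.
Proof. by rewrite nmM nmV. Qed.

Lemma nm_one_sub_conj z w : nm (1 - z^* * w) ^+ 2 =
  nm (w - z) ^+ 2 + (1 - nm z ^+ 2) * (1 - nm w ^+ 2).
Proof. by rewrite !nm_sqr !ReImE /=; ring. Qed.

Lemma nm_add_conj z w : nm (w + z^*) ^+ 2 = nm (w - z) ^+ 2 + 4 * Re z * Re w.
Proof. by rewrite !nm_sqr !ReImE; ring. Qed.

(** The modulus of the Moebius quotient tends to 1 uniformly at the circle. The first bound on [t]
    keeps u at distance (1 - a) / 2 from z; the second makes the excess (1 - a^2) (1 - |u|^2) at
    most (c^2 - 1) |u - z|^2. *)
Lemma nm_moebius_circle z (c : R) : nm z < 1 -> 1 < c ->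
  exists2 t : R, 0 < t & nm z < 1 - t /\
    forall u, 1 - t <= nm u -> nm u <= 1 -> nm (1 - z^* * u) <= c * nm (u - z).
Proof.
move=> z1 c1; set a := nm z in z1 *; have a0 : 0 <= a by exact: nm_ge0.
pose t := Num.min ((1 - a) / 2) ((c - 1) * (1 - a) ^+ 2 / 8).
have a1 : 0 < 1 - a by lra.
have a2 : 0 < (1 - a) ^+ 2 by rewrite exprn_gt0.
have t0 : 0 < t.
  by rewrite lt_min !divr_gt0 ?mulr_gt0//; lra.
have [t1 t2] : t <= (1 - a) / 2 /\ t <= (c - 1) * (1 - a) ^+ 2 / 8.
  by split; rewrite /t ge_min lexx ?orbT.
exists t => //; split; first lra.
move=> u tu u1.
have h1 : (1 - a) / 2 <= nm (u - z).
  by have := nmBB u z; rewrite -/a ler_norml => /andP[_]; lra.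
have h2 : (1 - a) ^+ 2 / 4 <= nm (u - z) ^+ 2.
  have -> : (1 - a) ^+ 2 / 4 = ((1 - a) / 2) ^+ 2 by field.
  by rewrite ler_pXn2r ?nnegrE ?nm_ge0//; lra.
rewrite -(ler_pXn2r (n := 2)) ?nnegrE ?mulr_ge0 ?nm_ge0//; last by lra.
rewrite nm_one_sub_conj exprMn -/a.
have h3 : (1 - a ^+ 2) * (1 - nm u ^+ 2) <= 2 * t.
  have u0 := nm_ge0 u.
  have q1 : 1 - nm u ^+ 2 <= 2 * t.
    have : (1 - nm u) * (1 + nm u) <= t * 2 by apply: ler_pM; lra.
    by rewrite expr2; lra.
  have q2 : 0 <= 1 - nm u ^+ 2.
    by rewrite subr_ge0 expr2 mulr_ile1.
  have q3 : 1 - a ^+ 2 <= 1 by have := sqr_ge0 a; lra.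
  by apply: le_trans q1; apply: ler_piMl.
have h4 : (c - 1) * ((1 - a) ^+ 2 / 4) <= (c ^+ 2 - 1) * nm (u - z) ^+ 2.
  apply: ler_pM => //; [lra | lra |].
  rewrite expr2; have : c * 1 <= c * c by apply: ler_wpM2l; lra.
  lra.
lra.
Qed.

Variable g : Cx R -> Cx R.
Hypothesis hol_g : forall u, nm u < 1 -> derivable g u 1.
Hypothesis pos_g : forall u, nm u < 1 -> 0 < Re (g u).

(** [g] followed by the Cayley transform of the half-plane onto the disc that sends g(z) to 0. *)
Let cayley z u := (g u - g z) / (g u + (g z)^*).

Lemma cayley_den z u : nm z < 1 -> nm u < 1 -> g u + (g z)^* != 0.
Proof.
move=> z1 u1; apply/eqP => H; have : Re (g u + (g z)^*) = 0 by rewrite H.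
rewrite !ReImE.
by have := pos_g z1; have := pos_g u1; lra.
Qed.

Lemma cayley_le1 z u : nm z < 1 -> nm u < 1 -> nm (cayley z u) <= 1.
Proof.
move=> z1 u1; rewrite nmM nmV ler_pdivrMr ?nm_gt0 ?cayley_den// mul1r.
rewrite -(ler_pXn2r (n := 2)) ?nnegrE ?nm_ge0// nm_add_conj lerDl.
by rewrite !mulr_ge0// ltW// pos_g.
Qed.

Lemma cayley_derivable z u : nm z < 1 -> nm u < 1 -> derivable (cayley z) u 1.
Proof.
move=> z1 u1; apply: derivableM.
  by apply: derivableB => //; exact: hol_g.
apply: derivableV; first exact: cayley_den.
by apply: derivableD => //; exact: hol_g.
Qed.

(* The two extra powers of [cayley z] remove the singularity at [z] without
   any appeal to a removable singularity theorem. *)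
Let quotient z k u := cayley z u ^+ k.+2 * ((1 - z^* * u) / (u - z)) ^+ k.

(** At z the bound |cayley| <= C |w - z| makes the quotient O(|w - z|^2), so its derivative there is
    0. *)
Lemma quotient_derivable z k u : nm z < 1 -> nm u < 1 -> derivable (quotient z k) u 1.
Proof.
move=> z1 u1; have [->{u u1}|uz] := eqVneq u z; last first.
  apply: derivableM; first exact/derivable_exp/cayley_derivable.
  apply: (@derivable_exp _ (fun u => (1 - z^* * u) / (u - z))).
  apply: derivableM.
    by apply: derivableB => //; apply: derivableM.
  by apply: derivableV; [rewrite subr_eq0 | apply: derivableB].
have cz : cayley z z = 0 by rewrite /cayley subrr mul0r.
have [l Hl] := (derivable_nmP _ _).1 (cayley_derivable z1 z1).
have [r r0 Hr] := Hl 1 ltr01.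
pose C := nm l + 1; have C0 : 0 < C by rewrite /C; have := nm_ge0 l; lra.
pose K := C ^+ 2 * (2 * C) ^+ k.
have K0 : 0 < K by rewrite mulr_gt0 ?exprn_gt0// mulr_gt0.
apply/derivable_nmP; exists 0 => e e0.
exists (Num.min (Num.min r (1 - nm z)) (e / K)).
  by rewrite !lt_min r0 subr_gt0 z1 divr_gt0.
move=> w; rewrite !lt_min => /andP[/andP[wr wz]]; rewrite ltr_pdivlMr// => wK.
rewrite {2}/quotient cz expr0n /= !mul0r !subr0.
have [->|wnz] := eqVneq w z; first by rewrite /quotient cz expr0n mul0r nm0 mulr_ge0 ?nm_ge0// ltW.
have d0 : 0 < nm (w - z) by rewrite nm_gt0 subr_eq0.
have w1 : nm w <= 1 by have := nmD (w - z) z; rewrite subrK; lra.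
have hc : nm (cayley z w) <= C * nm (w - z).
  have := Hr w wr; rewrite cz subr0 => h.
  have := nmD (cayley z w - l * (w - z)) (l * (w - z)); rewrite subrK nmM /C; lra.
have hb : nm (cayley z w) * nm ((1 - z^* * w) / (w - z)) <= 2 * C.
  rewrite (nm_div (1 - _) (w - z)) mulrA ler_pdivrMr//.
  have -> : 2 * C * nm (w - z) = C * nm (w - z) * 2 by ring.
  apply: ler_pM; rewrite ?nm_ge0//.
  apply: le_trans (nmB _ _) _; rewrite nm1 nmM nmJ.
  have : nm z * nm w <= 1 by rewrite mulr_ile1 ?nm_ge0// ltW.
  lra.
have -> : nm (quotient z k w) =
    nm (cayley z w) ^+ 2 * (nm (cayley z w) * nm ((1 - z^* * w) / (w - z))) ^+ k.
  by rewrite /quotient nmM !nmX exprMn -addn2 addnC exprD mulrA.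
apply: (@le_trans _ _ (K * nm (w - z) ^+ 2)).
  have -> : K * nm (w - z) ^+ 2 = (C * nm (w - z)) ^+ 2 * (2 * C) ^+ k by rewrite /K; ring.
  apply: ler_pM; [exact: sqr_ge0 | by apply: exprn_ge0; rewrite mulr_ge0 ?nm_ge0 | | ].
    by apply: lerXn2r; rewrite ?nnegrE ?nm_ge0// mulr_ge0 ?nm_ge0 ?(ltW C0).
  by apply: lerXn2r; rewrite ?nnegrE ?mulr_ge0 ?nm_ge0 ?(ltW C0).
by rewrite expr2 mulrA [K * _]mulrC; apply: ler_wpM2r; [exact: nm_ge0 | exact: ltW].
Qed.

(** Were the ratio x of the two sides above 1, take c strictly between 1 and x. Near the circle the
    quotient is at most c^k, while at w it is |cayley|^2 x^k: the two extra powers cost a fixed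
    factor, which (x / c)^k outgrows, against the maximum principle. *)
Lemma cayley_moebius z w : nm z < 1 -> nm w < 1 ->
  nm (cayley z w) * nm (1 - z^* * w) <= nm (w - z).
Proof.
move=> z1 w1; have [->|wz] := eqVneq w z.
  by rewrite /cayley !subrr mul0r nm0 mul0r.
have d0 : 0 < nm (w - z) by rewrite nm_gt0 subr_eq0.
rewrite leNgt; apply/negP => lt.
pose x := nm (cayley z w) * nm ((1 - z^* * w) / (w - z)).
have x1 : 1 < x by rewrite /x (nm_div (1 - _) (w - z)) mulrA ltr_pdivlMr// mul1r.
pose c := (1 + x) / 2.
have c1 : 1 < c by rewrite /c; lra.
have cx : c < x by rewrite /c; lra.
have [t t0 [zt Ht]] := nm_moebius_circle z1 c1.
pose rho := Num.max (1 - t) (Num.max (nm z) (nm w)).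
have [r1 r2 r3] : [/\ 1 - t <= rho, nm z <= rho & nm w <= rho].
  by split; rewrite /rho !le_max lexx ?orbT.
have rho1 : rho < 1 by rewrite !gt_max z1 w1 andbT; lra.
have f0 : 0 < nm (cayley z w).
  rewrite lt_def nm_ge0 andbT; apply/eqP => h.
  by move: x1; rewrite /x h mul0r ltr10.
have [k Hk] := @expr_unbounded R (x / c) (1 / nm (cayley z w) ^+ 2)
  ltac:(rewrite ltr_pdivlMr; lra).
have rho0 : 0 < rho by have := nm_ge0 z; lra.
have bd : forall u, nm u = rho -> nm (quotient z k u) <= c ^+ k.
  move=> u ur; have h2 : nm (1 - z^* * u) <= c * nm (u - z) by apply: Ht; rewrite ur// ltW.
  have u1 : nm u < 1 by rewrite ur.
  rewrite /quotient nmM !nmX -[X in _ <= X]mul1r.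
  apply: ler_pM; rewrite ?exprn_ge0 ?nm_ge0//.
    by rewrite exprn_ile1 ?nm_ge0 ?cayley_le1.
  have uz : 0 < nm (u - z).
    by have := nmBB u z; rewrite ler_norml ur => /andP[_]; lra.
  apply: lerXn2r; rewrite ?nnegrE ?nm_ge0//; first lra.
  by rewrite nm_div ler_pdivrMr.
have hol u : nm u <= rho -> derivable (quotient z k) u 1.
  by move=> ur; apply: quotient_derivable => //; exact: le_lt_trans rho1.
have := max_modulus rho0 hol bd r3; apply/negP; rewrite -ltNge.
have -> : nm (quotient z k w) = nm (cayley z w) ^+ 2 * x ^+ k.
  by rewrite /quotient nmM !nmX /x exprMn -addn2 addnC exprD mulrA.
move: Hk; rewrite ltr_pdivrMr ?exprn_gt0// expr_div_n.
have ck : 0 < c ^+ k by rewrite exprn_gt0//; lra.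
by rewrite mulrAC ltr_pdivlMr// mul1r mulrC.
Qed.

(** After squaring and clearing denominators, the product |g(w) - g(z)|^2 |w - z|^2 occurs on both
    sides and cancels. *)
Theorem schwarz_pick z w : nm z < 1 -> nm w < 1 ->
  nm (g w - g z) ^+ 2 * ((1 - nm z ^+ 2) * (1 - nm w ^+ 2)) <=
  4 * Re (g z) * Re (g w) * nm (w - z) ^+ 2.
Proof.
move=> z1 w1; have := cayley_moebius z1 w1.
rewrite /cayley nmM nmV mulrAC ler_pdivrMr ?nm_gt0 ?cayley_den// => h.
have := lerXn2r 2 _ _ h; rewrite !nnegrE !mulr_ge0 ?nm_ge0// => /(_ isT isT).
by rewrite !exprMn nm_one_sub_conj nm_add_conj; lra.
Qed.

End SchwarzPick.

(** * Chains of affine discs *)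

Section Chains.
Variables (R : realType) (d : nat) (Omega : set 'rV[Cx R]_d).
Implicit Types (x y z p v : 'rV[Cx R]_d) (L : R).
Local Notation Re := complex.Re.
Local Notation Im := complex.Im.

(** An upper bound on the Kobayashi distance kept together with its chain, so that bounds are
    concatenated without handling the infimum. *)
Definition chain_le x y L := exists (n : nat) (p : nat -> 'rV[Cx R]_d)
    (f : nat -> Cx R -> 'rV[Cx R]_d) (a b : nat -> Cx R),
  [/\ (0 < n)%N, disc_chain Omega n p f a b, p 0%N = x, p n = y &
      \sum_(i < n) poincare_dist (a i) (b i) <= L].

Lemma kobayashi_le x y L : chain_le x y L -> (kobayashi_dist Omega x y <= L%:E)%E.
Proof.
move=> [n [p [f [a [b [n0 ch p0 pn le]]]]]].
apply: (@le_trans _ _ (\sum_(i < n) poincare_dist (a i) (b i))%:E); last by rewrite lee_fin.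
by apply: ereal_inf_lbound; exists n, p, f, a, b.
Qed.

Lemma chain_le_weak x y L L' : L <= L' -> chain_le x y L -> chain_le x y L'.
Proof.
move=> LL [n [p [f [a [b [n0 ch p0 pn le]]]]]]; exists n, p, f, a, b.
by split => //; exact: le_trans LL.
Qed.

Lemma chain_le_disc (f : Cx R -> 'rV[Cx R]_d) (a b : Cx R) :
  holomorphic_disc Omega f -> unit_disc R a -> unit_disc R b ->
  chain_le (f a) (f b) (poincare_dist a b).
Proof.
move=> hf ha hb; exists 1%N, (fun i => if i is 0%N then f a else f b),
  (fun=> f), (fun=> a), (fun=> b).
by split => //; [case | rewrite big_ord1].
Qed.

Lemma chain_le_trans y x z L1 L2 :
  chain_le x y L1 -> chain_le y z L2 -> chain_le x z (L1 + L2).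
Proof.
move=> [n [p [f [a [b [n0 ch p0 pn le1]]]]]] [m [q [g [s [t [m0 ch' q0 qm le2]]]]]].
pose glue T (h k : nat -> T) i := if (i < n)%N then h i else k (i - n)%N.
exists (n + m)%N, (glue _ p q), (glue _ f g), (glue _ a s), (glue _ b t); split.
- by rewrite addn_gt0 n0.
- move=> i im; rewrite /glue; have [ilt|nle] := ltnP i n.
    have [h1 h2 h3 h4 h5] := ch i ilt; split => //.
    have [//|ni] := ltnP i.+1 n; rewrite h5.
    have -> : i.+1 = n by apply/eqP; rewrite eqn_leq ilt ni.
    by rewrite subnn q0 pn.
  have im' : (i - n < m)%N by rewrite ltn_subLR.
  have [h1 h2 h3 h4 h5] := ch' _ im'; split => //.
  by rewrite ltnNge (leqW nle) /= subSn.
- by rewrite /glue n0.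
- by rewrite /glue ltnNge leq_addr /= addKn.
- rewrite big_split_ord /=; apply: lerD.
    by apply: le_trans le1; apply: ler_sum => i _; rewrite /glue ltn_ord.
  apply: le_trans le2; apply: ler_sum => i _.
  by rewrite /glue ltnNge leq_addr /= addKn.
Qed.

Lemma affine_derivable p v (z : Cx R) : derivable (fun w : Cx R => p + w *: v) z 1.
Proof.
apply/cvg_ex; exists v; apply/cvg_nmP => e e0.
apply: (nbhs_nmP (0 : Cx R) [set h | h != 0 ->
  nm (h^-1 *: ((p + (h *: 1 + z) *: v) - (p + z *: v)) - v) < e]).2.
exists 1 => // h _ h0 /=.
rewrite [h *: 1]mulr1 opprD addrACA subrr add0r -scalerBl addrK scalerA mulVf// scale1r.
by rewrite subrr nm0.
Qed.

Lemma affine_disc p v : (forall w : Cx R, nm w < 1 -> Omega (p + w *: v)) ->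
  holomorphic_disc Omega (fun w => p + w *: v).
Proof.
move=> H z /unit_discE z1; split; [exact: affine_derivable | exact: H].
Qed.

Lemma realCM (x y : R) : ((x * y)%:C%C : Cx R) = x%:C%C * y%:C%C.
Proof. by rewrite rmorphM. Qed.

Lemma line_combine p v (a b c : Cx R) : p + a *: v + b *: (c *: v) = p + (a + b * c) *: v.
Proof. by rewrite scalerA scalerDl addrA. Qed.

Lemma conj_real (x : R) : (x%:C%C : Cx R)^* = x%:C%C.
Proof. by apply: eqC; rewrite ?ReJ ?ImJ //= oppr0. Qed.

Lemma poincare_real (a b : R) : -1 < a -> a <= b -> b < 1 ->
  poincare_dist (a%:C%C : Cx R) (b%:C%C : Cx R) =
  ln (((1 + b) * (1 - a)) / ((1 - b) * (1 + a))) / 2.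
Proof.
move=> a1 ab b1.
have ab1 : 0 < 1 - a * b.
  have h1 : 0 < (1 - a) * (1 + b) by rewrite mulr_gt0//; lra.
  have h2 : 0 < (1 + a) * (1 - b) by rewrite mulr_gt0//; lra.
  lra.
rewrite /poincare_dist /artanh -nmE.
have -> : (a%:C%C - b%:C%C) / (1 - a%:C%C * (b%:C%C : Cx R)^*) =
   ((a - b) / (1 - a * b))%:C%C :> Cx R.
  by rewrite conj_real rmorphM /= fmorphV rmorphB /= rmorphB rmorph1 rmorphM.
rewrite nm_real normrM normfV (gtr0_norm ab1) distrC (ger0_norm (_ : 0 <= b - a)); last by lra.
congr (ln _ / _); field.
by apply/and4P; split; apply/eqP => h; nra.
Qed.

Lemma poincare0 (z : Cx R) : poincare_dist 0 z = artanh (nm z).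
Proof.
by rewrite /poincare_dist -nmE sub0r mul0r subr0 divr1 nmN.
Qed.

Lemma chain_le_refl x : Omega x -> chain_le x x 0.
Proof.
move=> Ox; have hf : holomorphic_disc Omega (fun w : Cx R => x + w *: 0).
  by apply: affine_disc => w _; rewrite scaler0 addr0.
have u0 : unit_disc R 0 by apply/unit_discE; rewrite nm0.
have := chain_le_disc hf u0 u0; rewrite poincare0 nm0 /artanh subr0 addr0 divr1 ln1 mul0r.
by rewrite !scaler0 addr0.
Qed.

(** The bound is the Poincaré distance from s to t in the disc whose real diameter runs from [eta]
    to [2 * c - eta]. *)
Lemma chain_le_line p v (c eta s t : R) :
  eta < s -> s <= t -> t < 2 * c - eta ->
  (forall z : Cx R, nm (z - c%:C%C) < c - eta -> Omega (p + z *: v)) ->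
  chain_le (p + (s%:C%C : Cx R) *: v) (p + (t%:C%C : Cx R) *: v)
    (ln ((t - eta) * (2 * c - eta - s) / ((s - eta) * (2 * c - eta - t))) / 2).
Proof.
move=> es st tc H; pose r := c - eta; have r0 : 0 < r by rewrite /r; lra.
pose g (w : Cx R) : 'rV[Cx R]_d := (p + (c%:C%C : Cx R) *: v) + w *: ((r%:C%C : Cx R) *: v).
have gE (x : R) : g (((x - c) / r)%:C%C) = p + (x%:C%C : Cx R) *: v.
  rewrite /g line_combine; congr (_ + _ *: _).
  by apply: eqC; rewrite !ReImE /=; field; lra.
have hg : holomorphic_disc Omega g.
  apply: affine_disc => w w1; rewrite line_combine; apply: H.
  by rewrite addrAC subrr add0r nmM nm_real gtr0_norm// -/r -[X in _ < X]mul1r ltr_pM2r.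
have as1 : -1 < (s - c) / r by rewrite ltr_pdivlMr// /r; lra.
have bt1 : (t - c) / r < 1 by rewrite ltr_pdivrMr// /r; lra.
have ab : (s - c) / r <= (t - c) / r by rewrite ler_pM2r ?invr_gt0//; lra.
have ua : unit_disc R ((s - c) / r)%:C%C.
  by apply/unit_discE; rewrite nm_real ltr_norml as1 (le_lt_trans ab).
have ub : unit_disc R ((t - c) / r)%:C%C.
  by apply/unit_discE; rewrite nm_real ltr_norml bt1 (lt_le_trans as1).
have := chain_le_disc hg ua ub; rewrite !gE poincare_real//.
congr (chain_le _ _ (ln _ / _)); rewrite /r; field.
by apply/and3P; split; apply/eqP => h; lra.
Qed.

(** The half-plane would cost ln (t / s) / 2. Shrinking the disc by [eta] costs at most a factor 1 +
    2 eta / s inside the logarithm, and its finite size a factor 1 + t / c; then ln (1 + x) <= x. *)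
Lemma chain_le_step p v (c eta s t : R) : 0 < eta -> eta <= s / 2 ->
  eta <= c / 2 -> s <= t -> t <= c / 2 ->
  (forall z : Cx R, nm (z - c%:C%C) < c - eta -> Omega (p + z *: v)) ->
  chain_le (p + (s%:C%C : Cx R) *: v) (p + (t%:C%C : Cx R) *: v)
    (ln (t / s) / 2 + (eta / s + t / c / 2)).
Proof.
move=> e0 es ec st tc H.
have s0 : 0 < s by lra.
have t0 : 0 < t by lra.
have c0 : 0 < c by lra.
apply: chain_le_weak (@chain_le_line p v c eta s t _ st _ H); try lra.
have es0 : 0 < eta / s by rewrite divr_gt0.
have tc0 : 0 < t / c by rewrite divr_gt0.
have es1 : eta / s <= 1 / 2 by rewrite ler_pdivrMr//; lra.
have E : (t - eta) * (2 * c - eta - s) / ((s - eta) * (2 * c - eta - t)) <=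
    (t / s) * ((1 + 2 * (eta / s)) * (1 + t / c)).
  have -> : (t - eta) * (2 * c - eta - s) / ((s - eta) * (2 * c - eta - t)) =
    ((t - eta) / (s - eta)) * ((2 * c - eta - s) / (2 * c - eta - t)).
    by field; apply/andP; split; apply/eqP => h; lra.
  rewrite [X in _ <= X]mulrA; apply: ler_pM.
  - by rewrite divr_ge0//; lra.
  - by rewrite divr_ge0//; lra.
  - rewrite ler_pdivrMr; last by lra.
    have -> : t / s * (1 + 2 * (eta / s)) * (s - eta) =
      t * ((1 + 2 * (eta / s)) * (1 - eta / s)) by field; lra.
    have : 1 <= (1 + 2 * (eta / s)) * (1 - eta / s).
      have : 0 <= eta / s * (1 - 2 * (eta / s)) by rewrite mulr_ge0//; lra.
      lra.
    by move=> /(ler_wpM2l (ltW t0)); lra.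
  - rewrite ler_pdivrMr; last by lra.
    have : t / c * c <= t / c * (2 * c - eta - t) by apply: ler_wpM2l; lra.
    by rewrite divfK ?gt_eqF//; lra.
have X0 : 0 < (t - eta) * (2 * c - eta - s) / ((s - eta) * (2 * c - eta - t)).
  by rewrite divr_gt0// mulr_gt0//; lra.
have Y0 : 0 < t / s by rewrite divr_gt0.
have h1 : 0 < 1 + 2 * (eta / s) by lra.
have h2 : 0 < 1 + t / c by lra.
have Yp : 0 < t / s * ((1 + 2 * (eta / s)) * (1 + t / c)).
  by rewrite (mulr_gt0 Y0)// mulr_gt0.
have := E; rewrite -(@ler_ln R) ?posrE//.
have -> : ln (t / s * ((1 + 2 * (eta / s)) * (1 + t / c))) =
    ln (t / s) + (ln (1 + 2 * (eta / s)) + ln (1 + t / c)).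
  rewrite lnM; [ | by rewrite posrE | by rewrite posrE mulr_gt0].
  by rewrite (@lnM R (1 + 2 * (eta / s))) ?posrE.
have := @le_ln1Dx R (2 * (eta / s)) ltac:(lra).
have := @le_ln1Dx R (t / c) ltac:(lra).
lra.
Qed.

Lemma ln_chain (x y z : R) : 0 < x -> 0 < y -> 0 < z ->
  ln (y / x) + ln (z / y) = ln (z / x).
Proof.
move=> x0 y0 z0; rewrite !ln_div ?posrE//; lra.
Qed.

(* Round discs of radius about [c_i = r0 a^i] approximate the region
   [Re z > K |z|^(1+alpha)] so well that replacing it by a half-plane costs only
   a geometric series. *)
Lemma chain_le_pinched (alpha K r : R) : 0 < alpha -> 0 < K -> 0 < r ->
  exists2 t0 : R, [/\ 0 < t0, 2 * t0 < r & K * (2 * t0) `^ alpha * (2 * t0) <= t0 / 4] & forall p v,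
  (forall z : Cx R, nm z < r -> K * nm z `^ alpha * nm z < Re z -> Omega (p + z *: v)) ->
  forall s : R, 0 < s <= t0 ->
  chain_le (p + (s%:C%C : Cx R) *: v) (p + (t0%:C%C : Cx R) *: v) (ln (t0 / s) / 2 + 1).
Proof.
move=> al0 K0 r_gt0.
have al1 : alpha^-1 * alpha = 1 by rewrite mulVf ?gt_eqF.
(* The ratio of successive scales: a^alpha <= 1/4 makes the pinching, measured in units of the
   scale, decay like 4^-i. *)
pose a : R := (4^-1) `^ alpha^-1 / 2.
have a0 : 0 < a by rewrite divr_gt0// powR_gt0// invr_gt0.
have q1 : (4^-1) `^ alpha^-1 <= 1 :> R.
  have : (4^-1) `^ alpha^-1 <= 1 `^ alpha^-1 :> R.
    apply: ge0_ler_powR; rewrite ?nnegrE ?invr_ge0 ?(ltW al0)//.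
    by rewrite invf_le1//; lra.
  by rewrite powR1.
have a12 : a <= 1 / 2 by rewrite /a; lra.
have aal : a `^ alpha <= 1 / 4.
  apply: (@le_trans _ _ (((4^-1) `^ alpha^-1) `^ alpha)).
    apply: ge0_ler_powR; rewrite ?nnegrE ?(ltW al0) ?(ltW a0) ?powR_ge0//.
    by rewrite /a; have := powR_ge0 (4^-1 : R) alpha^-1; lra.
  by rewrite -powRrM al1 powRr1 ?invr_ge0//; lra.
pose k : R := a / 16; have k0 : 0 < k by rewrite divr_gt0.
pose b : R := (k / (8 * K)) `^ alpha^-1.
have b0 : 0 < b by rewrite powR_gt0// divr_gt0// mulr_gt0.
have bal : b `^ alpha = k / (8 * K).
  by rewrite /b -powRrM al1 powRr1// divr_ge0 ?mulr_ge0// ltW.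
pose r0 : R := Num.min b r / 2.
have r00 : 0 < r0 by rewrite divr_gt0// lt_min b0.
have [r0b r0r] : 2 * r0 <= b /\ 2 * r0 <= r.
  by split; rewrite /r0 mulrC divfK// ge_min lexx ?orbT.
(* [c i] is the centre of the i-th disc, [eta i] its gap to 0, and [t i] the point where disc i+1
   hands over to the coarser ones. On disc i+1 the two errors of [chain_le_step] are at most 2^-i /
   8 and 2^-i / 32. *)
pose c i : R := r0 * a ^+ i.
pose t i : R := k * c i / 2 ^+ i.
pose eta i : R := k / 4 * c i / 4 ^+ i.
have c0 i : 0 < c i by rewrite mulr_gt0// exprn_gt0.
have t0 i : 0 < t i by rewrite divr_gt0 ?exprn_gt0// mulr_gt0.
have eta0 i : 0 < eta i by rewrite divr_gt0 ?exprn_gt0// mulr_gt0// divr_gt0.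
have c_le i : c i <= r0.
  rewrite /c -[X in _ <= X]mulr1 ler_pM2l// exprn_ile1//; first exact: ltW.
  by lra.
have eta_t i : eta i = t i / (4 * 2 ^+ i).
  rewrite /eta /t; have -> : 4 = 2 * 2 :> R by lra.
  by rewrite exprMn; field; rewrite expf_neq0.
have p2 i : 1 <= 2 ^+ i :> R by rewrite exprn_ege1//; lra.
have eta_le_t i : eta i <= t i / 4.
  rewrite eta_t invfM mulrA; apply: ler_piMr; first by rewrite divr_ge0// ltW.
  by rewrite invf_le1// exprn_gt0.
have t_le_c i : t i <= c i / 32.
  rewrite /t ler_pdivrMr ?exprn_gt0//.
  have h : k * c i <= c i / 32 by rewrite mulrC; apply: ler_wpM2l; [exact: ltW | rewrite /k; lra].
  apply: le_trans h _; rewrite -{1}[c i / 32]mulr1; apply: ler_wpM2l => //.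
  by rewrite divr_ge0// ltW.
have pow_c i : K * (2 * c i) `^ alpha * (2 * c i) <= eta i.
  have h1 : (2 * c i) `^ alpha <= k / (8 * K) / 4 ^+ i.
    have rr : 0 <= 2 * r0 by have := ltW r00; lra.
    rewrite /c mulrA powRM ?rr ?exprn_ge0 ?(ltW a0)//.
    apply: ler_pM; rewrite ?powR_ge0//.
      rewrite -bal; apply: ge0_ler_powR; [exact: ltW | | by rewrite nnegrE ltW | exact: r0b].
      by rewrite nnegrE; have := ltW r00; lra.
    rewrite -powR_mulrn ?(ltW a0)// powRAC powR_mulrn ?powR_ge0// -exprVn.
    by apply: lerXn2r; rewrite ?nnegrE ?powR_ge0 ?invr_ge0//; lra.
  have -> : eta i = K * (k / (8 * K) / 4 ^+ i) * (2 * c i).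
    by rewrite /eta; field; rewrite expf_neq0//= gt_eqF.
  by apply: ler_wpM2r; [rewrite mulr_ge0// ltW | apply: ler_wpM2l; [exact: ltW|]].
have t0r : t 0%N < r.
  by have := t_le_c 0%N; have := c_le 0%N; lra.
have t00 := t0 0%N.
(* The side conditions on the endpoint serve to find a ball of fixed size around it inside the
   domain. *)
exists (t 0%N); first split => //.
- by have := t_le_c 0%N; have := c_le 0%N; lra.
- apply: le_trans (le_trans (pow_c 0%N) (eta_le_t 0%N)).
  have tc : 2 * t 0%N <= 2 * c 0%N by have := t_le_c 0%N; have := c0 0%N; lra.
  apply: ler_pM; [by rewrite mulr_ge0 ?powR_ge0// ltW | by lra | | exact: tc].
  rewrite ler_pM2l//; apply: ge0_ler_powR; [exact: ltW | by rewrite nnegrE; lra | | exact: tc].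
  by rewrite nnegrE; have := c0 0%N; lra.
move=> p v H.
(* In this disc |z| < 2 c_i and Re z > eta_i, and [pow_c] bounds K |z|^(1+alpha) by eta_i. *)
have disc i (z : Cx R) : nm (z - (c i)%:C%C) < c i - eta i -> Omega (p + z *: v).
  move=> zc; have z2 : nm z < 2 * c i.
    have := nmD (z - (c i)%:C%C) ((c i)%:C%C); rewrite subrK nm_real gtr0_norm//.
    by have := eta0 i; lra.
  have zre : eta i < Re z.
    have := le_Re_nm (z - (c i)%:C%C); rewrite ReD ReN /= ler_norml => /andP[+ _]; lra.
  apply: H; first by have := c_le i; lra.
  apply: le_lt_trans zre; apply: le_trans (pow_c i).
  apply: ler_pM; [by rewrite mulr_ge0 ?powR_ge0// ltW | exact: nm_ge0 | | exact: ltW].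
  rewrite ler_pM2l//; apply: ge0_ler_powR; [exact: ltW | by rewrite nnegrE nm_ge0 | | exact: ltW].
  by rewrite nnegrE; have := c0 i; lra.
(* Passing from i to i+1 raises the allowance by 2^-i / 2, which covers 2^-i / 8 + 2^-i / 32. *)
have main i (s : R) : t i <= s <= t 0%N ->
    chain_le (p + (s%:C%C : Cx R) *: v) (p + ((t 0%N)%:C%C : Cx R) *: v)
      (ln (t 0%N / s) / 2 + (1 - (2 ^+ i)^-1)).
  elim: i s => [|i ih] s /andP[ts st].
    have -> : s = t 0%N by apply/eqP; rewrite eq_le st ts.
    rewrite divff ?gt_eqF// ln1 mul0r add0r expr0 invr1 subrr.
    apply: chain_le_refl; apply: (disc 0%N).
    have -> : (t 0%N)%:C%C - (c 0%N)%:C%C = (t 0%N - c 0%N)%:C%C :> Cx R by rewrite rmorphB.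
    rewrite nm_real distrC gtr0_norm; have := t_le_c 0%N; have := eta_le_t 0%N; have := t0 0%N; have := c0 0%N; lra.
  have [tis|sti] := lerP (t i) s.
    apply: chain_le_weak (ih s _); last by rewrite tis.
    rewrite lerD2l lerD2l lerN2 exprS invfM; apply: ler_piMl; last by lra.
    by rewrite invr_ge0 exprn_ge0.
  have ti0 : t i <= t 0%N.
    rewrite /t expr0 divr1 ler_pdivrMr ?exprn_gt0//.
    apply: (@le_trans _ _ (k * c 0%N * 1)).
      rewrite mulr1 ler_pM2l// /c expr0 mulr1; exact: c_le.
    by apply: ler_wpM2l => //; rewrite mulr_ge0// ltW.
  have tlt : t i = c i.+1 / (16 * 2 ^+ i).
    by rewrite /t /k /c exprS; field; rewrite expf_neq0.
  have s0 : 0 < s by exact: lt_le_trans ts.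
  have st1 : eta i.+1 / s <= (2 ^+ i)^-1 / 8.
    rewrite ler_pdivrMr// eta_t exprS.
    have -> : t i.+1 / (4 * (2 * 2 ^+ i)) = (2 ^+ i)^-1 / 8 * t i.+1.
      by field; rewrite expf_neq0.
    by rewrite ler_pM2l// divr_gt0// invr_gt0 exprn_gt0.
  have st2 : t i / c i.+1 / 2 = (2 ^+ i)^-1 / 32.
    by rewrite tlt; field; rewrite expf_neq0//= gt_eqF.
  have ci : t i <= c i.+1 / 2.
    rewrite tlt; apply: ler_wpM2l; first exact: ltW.
    rewrite lef_pV2 ?posrE ?mulr_gt0 ?exprn_gt0//; have := p2 i; lra.
  have step : chain_le (p + (s%:C%C : Cx R) *: v) (p + ((t i)%:C%C : Cx R) *: v)
      (ln (t i / s) / 2 + (eta i.+1 / s + t i / c i.+1 / 2)).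
    apply: chain_le_step => //.
    - by have := eta_le_t i.+1; lra.
    - by have := eta_le_t i.+1; have := t_le_c i.+1; have := c0 i.+1; lra.
    - exact: ltW.
    - exact: disc.
  have ih' := ih (t i) ltac:(by rewrite lexx ti0).
  apply: chain_le_weak (chain_le_trans step ih').
  have := ln_chain s0 (t0 i) (t0 0%N); rewrite st2 exprS invfM.
  have i2 : 0 < (2 ^+ i)^-1 :> R by rewrite invr_gt0 exprn_gt0.
  lra.
move=> s /andP[s0 st].
have [i Hi] := @expr_unbounded R 2 (k * r0 / s) ltac:(lra).
have tis : t i <= s.
  rewrite ltr_pdivrMr// in Hi; rewrite /t ler_pdivrMr ?exprn_gt0//.
  apply: le_trans (ltW _); last by rewrite mulrC; exact: Hi.
  by rewrite ler_pM2l// c_le.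
apply: chain_le_weak (main i s _); last by rewrite tis.
by rewrite lerD2l gerBl invr_ge0 exprn_ge0.
Qed.

End Chains.

(** * Chains between points away from the boundary of a convex set *)

Section ConvexChains.
Variables (R : realType) (d : nat) (Omega : set 'rV[Cx R]_d).
Hypothesis convO : convex_set Omega.
Implicit Types (x y : 'rV[Cx R]_d).

Lemma convex_segment x y (t : R) : Omega x -> Omega y -> 0 <= t <= 1 ->
  Omega (x + (t%:C%C : Cx R) *: (y - x)).
Proof.
move=> Ox Oy /andP[t0 t1].
have c0 : (0 : Cx R) <= t%:C%C by rewrite ler0c.
have c1 : (t%:C%C : Cx R) <= 1 by rewrite -[1]/(1%:C%C : Cx R) lecR.
have := convO (Itv01 c0 c1) (mem_set Oy) (mem_set Ox); rewrite inE.
congr Omega; rewrite /conv /= scalerBl scale1r scalerBr addrC -addrA.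
by congr (_ + _); rewrite addrC.
Qed.

(** By convexity the k-neighbourhood of the whole segment lies in Omega. It is crossed by [n] affine
    discs of radius below k, each from its centre to half its radius; [n] depends on k and D only,
    which makes the cost uniform in x and y. *)
Lemma chain_le_balls (k D : R) : 0 < k -> exists C : R, forall x y,
  nm (y - x) <= D -> (forall z, nm (z - x) < k -> Omega z) ->
  (forall z, nm (z - y) < k -> Omega z) -> chain_le Omega x y C.
Proof.
move=> k0; pose n := (Num.truncn (2 * `|D| / k)).+1.
have nD : 2 * `|D| < n%:R * k by rewrite -ltr_pdivrMr//; exact: truncnS_gt.
have n0 : 0 < n%:R :> R by rewrite ltr0n.
pose h : Cx R := (2^-1)%:C%C.
have u0 : unit_disc R 0 by apply/unit_discE; rewrite nm0.
have uh : unit_disc R h.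
  by apply/unit_discE; rewrite nm_real ger0_norm ?invr_ge0// invf_lt1//; lra.
exists (n%:R * poincare_dist 0 h) => x y xyD bx by_.
pose q (i : nat) := x + ((i%:R / n%:R)%:C%C : Cx R) *: (y - x).
have ball i z : (i <= n)%N -> nm (z - q i) < k -> Omega z.
  move=> i_n zq; have -> : z = (x + (z - q i)) +
      ((i%:R / n%:R)%:C%C : Cx R) *: ((y + (z - q i)) - (x + (z - q i))).
    have E w : x + w + ((i%:R / n%:R)%:C%C : Cx R) *: ((y + w) - (x + w)) = q i + w.
      by rewrite opprD addrACA subrr addr0 addrAC.
    by rewrite E subrKC.
  apply: convex_segment.
  - by apply: bx; rewrite addrAC subrr add0r.
  - by apply: by_; rewrite addrAC subrr add0r.
  - by rewrite divr_ge0 ?ler0n//= ler_pdivrMr// mul1r ler_nat.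
have step i : (i < n)%N -> chain_le Omega (q i) (q i.+1) (poincare_dist 0 h).
  move=> i_n; pose v := ((2 / n%:R)%:C%C : Cx R) *: (y - x).
  have hv : holomorphic_disc Omega (fun w => q i + w *: v).
    apply: affine_disc => w w1; apply: (ball i); first exact: ltnW.
    rewrite addrAC subrr add0r !nmZ nm_real ger0_norm ?divr_ge0 ?ler0n//.
    apply: (@le_lt_trans _ _ (2 / n%:R * nm (y - x))).
      by apply: ler_piMl; [rewrite mulr_ge0 ?nm_ge0 ?divr_ge0 ?ler0n | exact: ltW].
    rewrite mulrAC ltr_pdivrMr// [k * _]mulrC; apply: le_lt_trans nD.
    by rewrite ler_pM2l// (le_trans xyD) ?ler_norm.
  have E : q i + h *: v = q i.+1.
    rewrite /q /v line_combine; congr (_ + _ *: _).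
    apply: eqC; rewrite /h !ReImE /= -?natr1; first by field; rewrite gt_eqF.
    by ring.
  by have := chain_le_disc hv u0 uh; rewrite scale0r addr0 E.
have all i : (i <= n)%N -> chain_le Omega x (q i) (i%:R * poincare_dist 0 h).
  elim: i => [|i ih] i_n.
    rewrite mul0r /q mul0r scale0r addr0; apply: chain_le_refl.
    by apply: bx; rewrite subrr nm0.
  rewrite -natr1 mulrDl mul1r; apply: chain_le_trans (step i i_n).
  by apply: ih; exact: ltnW.
have := all n (leqnn n); rewrite /q divff ?gt_eqF// scale1r.
by rewrite addrC subrK.
Qed.

End ConvexChains.

(** * Boundary points and supporting functionals *)

Section Coordinates.
Variables (R : realType) (d : nat).
Implicit Types (u v w b : 'rV[Cx R]_d) (x : 'rV[R]_d).
Local Notation Re := complex.Re.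
Local Notation Im := complex.Im.

Lemma nm_coord v j : nm (v ord0 j) <= nm v.
Proof.
rewrite -lecR -!normE [leRHS]/Num.Def.normr /= mx_normE -[leLHS]nngE num_le.
exact: (le_bigmax _ (fun i => `|v i.1 i.2|%:nng) (ord0, j)).
Qed.

Lemma nm_le_coord v (e : R) : 0 <= e -> (forall j, nm (v ord0 j) <= e) -> nm v <= e.
Proof.
move=> e0 H; rewrite -lecR -normE [leLHS]/Num.Def.normr /= mx_normE.
have e0' : (0 : Cx R) <= e%:C%C by rewrite ler0c.
rewrite (_ : (e%:C%C : Cx R) = (NngNum e0')%:num)// num_le.
apply/bigmax_leP; split; first by rewrite -num_le.
by move=> [i j] _; rewrite -num_le /= (ord1 i) normE lecR.
Qed.

Lemma norm_le_coord x (e : R) : 0 <= e -> (forall j, `|x ord0 j| <= e) -> `|x| <= e.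
Proof.
move=> e0 H; rewrite [leLHS]/Num.Def.normr /= mx_normrE.
by apply: bigmax_le => // -[i j] _; rewrite (ord1 i).
Qed.

Lemma compact_nm_ball (r : R) : 0 <= r -> compact [set v : 'rV[Cx R]_d | nm v <= r].
Proof.
move=> r0; have K := @rV_compact (Cx R) d (fun=> [set z : Cx R | nm z <= r])
  (fun=> @compact_disc R r).
rewrite (_ : mkset _ = [set v : 'rV[Cx R]_d | forall i, [set z : Cx R | nm z <= r] (v ord0 i)])//.
apply/seteqP; split => v /=; first by move=> vr i; rewrite (le_trans (nm_coord v i)).
by move=> H; apply: nm_le_coord.
Qed.

(* The pairing is bilinear (no conjugation), so that [ell b] is complex linear. *)
Definition ell b v : Cx R := (v *m b^T) ord0 ord0.

Lemma ellE b v : ell b v = \sum_j v ord0 j * b ord0 j.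
Proof. by rewrite /ell mxE; apply: eq_bigr => j _; rewrite mxE. Qed.

Lemma ellD b u v : ell b (u + v) = ell b u + ell b v.
Proof. by rewrite /ell mulmxDl mxE. Qed.
Lemma ellB b u v : ell b (u - v) = ell b u - ell b v.
Proof. by rewrite /ell mulmxBl !mxE. Qed.
Lemma ellZ b (c : Cx R) v : ell b (c *: v) = c * ell b v.
Proof. by rewrite /ell -scalemxAl mxE. Qed.
Lemma ellZl b (c : Cx R) v : ell (c *: b) v = c * ell b v.
Proof. by rewrite /ell linearZ /= -scalemxAr mxE. Qed.

Lemma nm_sum (I : finType) (F : I -> Cx R) : nm (\sum_i F i) <= \sum_i nm (F i).
Proof.
elim/big_ind2 : _ => //; first by rewrite nm0.
by move=> x1 x2 y1 y2 h1 h2; apply: le_trans (nmD _ _) _; exact: lerD.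
Qed.

Lemma nm_ell b v : nm (ell b v) <= d%:R * (nm b * nm v).
Proof.
rewrite ellE; apply: le_trans (nm_sum _) _.
rewrite -[d in d%:R]card_ord -sum1_card natr_sum mulr_suml.
apply: ler_sum => j _; rewrite mul1r nmM mulrC.
by apply: ler_pM; rewrite ?nm_ge0 ?nm_coord.
Qed.

Lemma Re_sum (I : finType) (F : I -> Cx R) : Re (\sum_i F i) = \sum_i Re (F i).
Proof. by elim/big_ind2 : _ => // x1 x2 y1 y2 <- <-; rewrite ReD. Qed.

Lemma ell_rotate b v : exists2 c : Cx R, nm c = 1 & Re (ell b (c *: v)) = - nm (ell b v).
Proof.
have [z0|nz] := eqVneq (ell b v) 0.
  by exists 1; rewrite ?nm1// scale1r z0 nm0 oppr0.
have n0 : 0 < nm (ell b v) by rewrite nm_gt0.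
exists (- ((nm (ell b v))%:C%C : Cx R) / ell b v).
  by rewrite nmM nmV nmN nm_real gtr0_norm// divff// gt_eqF.
by rewrite ellZ divfK// ReN.
Qed.

Lemma realifyD u v : realify (u + v) = realify u + realify v.
Proof. by congr (_, _); apply/rowP => j; rewrite !mxE ?ReD ?ImD. Qed.

Lemma realifyB u v : realify (u - v) = realify u - realify v.
Proof. by congr (_, _); apply/rowP => j; rewrite !mxE ?ReD ?ImD ?ReN ?ImN. Qed.

Lemma realifyZ (t : R) v : realify ((t%:C%C : Cx R) *: v) = t *: realify v.
Proof.
by congr (_, _); apply/rowP => j; rewrite !mxE ?ReM ?ImM /= mul0r ?subr0 ?addr0.
Qed.

Lemma norm_realify v : `|realify v| <= nm v.
Proof.
rewrite prod_normE ge_max; apply/andP; split; apply: norm_le_coord; rewrite ?nm_ge0// => j;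
  rewrite !mxE; apply: le_trans (nm_coord v j); [exact: le_Re_nm | exact: le_Im_nm].
Qed.

Lemma realify_surj (x : 'rV[R]_d * 'rV[R]_d) : exists v, realify v = x.
Proof.
exists (\row_j (x.1 ord0 j +i* x.2 ord0 j)%C).
by case: x => x y; congr (_, _); apply/rowP => j; rewrite !mxE.
Qed.

(** A real linear form is the real part of the complex form L(v) - i L(iv). *)
Lemma ell_of_linear (L : 'rV[R]_d * 'rV[R]_d -> R) :
  (forall y z, L (y + z) = L y + L z) ->
  (forall (t : R) y, L (t *: y) = t * L y) ->
  exists b, forall v, Re (ell b v) = L (realify v).
Proof.
move=> LD LZ.
exists (\row_j ((L (delta_mx ord0 j, 0)) +i* (- L (0, delta_mx ord0 j)))%C) => v.
rewrite ellE Re_sum.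
have -> : realify v = \sum_j (Re (v ord0 j) *: (delta_mx ord0 j, 0) +
    Im (v ord0 j) *: (0, delta_mx ord0 j)).
  have E (f g : 'I_d -> 'rV[R]_d) : \sum_j (f j, g j) = (\sum_j f j, \sum_j g j).
    by elim/big_rec3 : _ => // j a b c _ ->.
  rewrite (eq_bigr (fun j => (Re (v ord0 j) *: delta_mx ord0 j,
     Im (v ord0 j) *: delta_mx ord0 j))); last first.
    by move=> j _; apply: injective_projections; rewrite /= scaler0 ?addr0 ?add0r.
  rewrite E; congr (_, _).
    by rewrite [LHS]row_sum_delta; apply: eq_bigr => j _; rewrite mxE.
  by rewrite [LHS]row_sum_delta; apply: eq_bigr => j _; rewrite mxE.
have L0 : L 0 = 0 by rewrite -(scale0r (0 : 'rV[R]_d * 'rV[R]_d)) LZ mul0r.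
rewrite (big_morph L LD L0); apply: eq_bigr => j _.
by rewrite LD !LZ mxE ReM /=; lra.
Qed.

End Coordinates.

(** * First-order calculus for the defining function *)

Section DefiningFunction.
Variables (R : realType) (V : normedModType R) (rho : V -> R).
Implicit Types x v : V.

Lemma is_derive_line x v (t : R) : differentiable rho (x + t *: v) ->
  is_derive t (1 : R) (fun s : R => rho (x + s *: v)) ('d rho (x + t *: v) v).
Proof.
move=> df; have dv : derivable rho _ v := diff_derivable df.
have E : (fun h : R => h^-1 *: (((fun s : R => rho (x + s *: v)) \o shift t) (h *: 1) - rho (x + t *: v))) =
   (fun h : R => h^-1 *: ((rho \o shift (x + t *: v)) (h *: v) - rho (x + t *: v))).
  apply/funext => h /=; rewrite [h *: 1]mulr1 scalerDl addrCA.
  by [].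
split; first by rewrite /derivable E; exact: dv.
by rewrite /derive E -deriveE.
Qed.

Lemma segment_mvt x v : (forall t : R, 0 <= t <= 1 -> differentiable rho (x + t *: v)) ->
  exists2 t : R, 0 <= t <= 1 & rho (x + v) - rho x = 'd rho (x + t *: v) v.
Proof.
move=> df; have [||t t01] := @MVT_segment R (fun s : R => rho (x + s *: v))
   (fun t => 'd rho (x + t *: v) v) 0 1 ler01.
- move=> t; rewrite in_itv /= => /andP[t0 t1]; apply: is_derive_line; apply: df.
  by rewrite !ltW.
- apply: continuous_in_subspaceT => t; rewrite inE /= in_itv /= => t01.
  apply: differentiable_continuous; apply/derivable1_diffP.
  by have [] := is_derive_line (df t t01).
rewrite scale1r scale0r addr0 subr0 mulr1 => E; exists t => //.
Qed.

Lemma diff_le0 x v : differentiable rho x ->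
  (forall e : R, 0 < e -> exists2 t : R, 0 < t < e & rho (x + t *: v) <= rho x) -> 'd rho x v <= 0.
Proof.
move=> df H; rewrite leNgt; apply/negP => pos.
have dv : derivable rho _ v := diff_derivable df.
have : h^-1 *: ((rho \o shift x) (h *: v) - rho x) @[h --> 0^'] --> 'd rho x v.
  by rewrite -deriveE.
move=> /cvgrPdist_lt /(_ _ pos); rewrite /dnbhs /within /=.
move=> /nbhs_ballP[r /= r0 Hr]; have [t /andP[t0 tr] le] := H r r0.
have := Hr t; rewrite /ball /= sub0r normrN gtr0_norm// => /(_ tr).
rewrite gt_eqF// => /(_ isT); rewrite ltr_norml => /andP[_].
rewrite ltrBlDr ltrDl => q0.
have : t^-1 * (rho (t *: v + x) - rho x) <= 0.
  by rewrite pmulr_rle0 ?invr_gt0// subr_le0 addrC.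
by move=> /(lt_le_trans q0); rewrite ltxx.
Qed.

End DefiningFunction.

Lemma le_powR (R : realType) (a x y : R) : 0 < a -> 0 <= x -> x <= y -> x `^ a <= y `^ a.
Proof.
move=> a0 x0 xy; apply: ge0_ler_powR; rewrite ?nnegrE ?(ltW a0)//; exact: le_trans xy.
Qed.

Lemma half_close (R : realType) (A B K e : R) :
  `|A - B| <= K -> K <= `|B| / 2 -> e <= `|B| / 2 -> e <= `|A|.
Proof. by move=> h1 h2 h3; have := lerB_dist B A; rewrite distrC; lra. Qed.

Lemma increment_lt0 (R : realType) (r1 r0 D1 D0 K1 K2 : R) : r1 - r0 = D1 -> r0 <= 0 ->
  `|D1 - D0| <= K1 -> K1 <= K2 -> K2 < - D0 -> r1 < 0.
Proof. by move=> h1 h2; rewrite ler_norml => /andP[h3 h4] h5 h6; lra. Qed.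

(** * Nearest points and regular boundary points of an open convex set *)

Section ConvexDomain.
Variables (R : realType) (d : nat) (Omega : set 'rV[Cx R]_d).
Implicit Types (p q x y v w b : 'rV[Cx R]_d).
Local Notation Re := complex.Re.
Local Notation Im := complex.Im.
Hypothesis openO : open Omega.
Hypothesis convO : convex_set Omega.

Lemma boundaryE p : boundary Omega p <-> closure Omega p /\ ~ Omega p.
Proof.
rewrite /boundary; have -> : interior Omega = Omega.
  by apply/seteqP; split; [exact: interior_subset | rewrite -open_subsetE].
by split.
Qed.

(** p is replaced by a nearby q in Omega, and y by y - w with w = ((1 - t) / t) (q - p), still in
    Omega; the point of the segment at parameter t is unchanged. *)
Lemma closure_segment p y (t : R) : closure Omega p -> Omega y -> 0 < t <= 1 ->
  Omega (p + (t%:C%C : Cx R) *: (y - p)).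
Proof.
move=> cp Oy /andP[t0 t1].
have [r r0 Hr] := (open_nmP _).1 openO y Oy.
have [|q Oq qp] := (closure_nmP _ _).1 cp (t * r); first by rewrite mulr_gt0.
pose s : Cx R := t%:C%C.
have s0 : s != 0 by rewrite -nm_gt0 nm_real gtr0_norm.
pose w := s^-1 *: ((1 - s) *: (q - p)).
have ww : nm w <= t^-1 * nm (q - p).
  have -> : nm w = t^-1 * (nm (1 - s) * nm (q - p)).
    by rewrite /w !nmZ nmV nm_real gtr0_norm.
  rewrite ler_pM2l ?invr_gt0//; apply: ler_piMl; first exact: nm_ge0.
  have -> : 1 - s = (1 - t)%:C%C :> Cx R by rewrite rmorphB.
  by rewrite nm_real ger0_norm; lra.
have Oz : Omega (y - w).
  apply: Hr; rewrite addrAC subrr add0r nmN (le_lt_trans ww)//.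
  by rewrite mulrC ltr_pdivrMr// mulrC.
have t01 : 0 <= t <= 1 by rewrite t1 ltW.
have := convex_segment convO Oq Oz t01; congr Omega.
by apply/rowP => j; rewrite /w !mxE -/s; field.
Qed.

(** p minimises the distance to x over the complement of Omega, within a compact ball that contains
    an outside point [y0]. Points of the segment just after p are closer to x, hence in Omega, which
    puts p in the closure. *)
Lemma nearest_boundary_point (B : R) x : (0 < d)%N -> (forall y, Omega y -> nm y <= B) ->
  Omega x -> exists2 p, boundary Omega p & forall y, nm (y - x) < nm (p - x) -> Omega y.
Proof.
move=> d0 bO Ox; have B0 : 0 <= B by apply: le_trans (bO x Ox); exact: nm_ge0.
pose y0 : 'rV[Cx R]_d := const_mx ((B + 1)%:C%C).
have y0O : ~ Omega y0.
  move=> /bO; apply/negP; rewrite -ltNge.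
  apply: lt_le_trans (nm_coord y0 (Ordinal d0)).
  by rewrite mxE nm_real ger0_norm; lra.
pose S := [set y | nm y <= nm (y0 - x) + nm x] `&` (~` Omega).
have cS : compact S.
  apply: compact_closedI; last exact: open_closedC.
  by apply: compact_nm_ball; rewrite addr_ge0 ?nm_ge0.
have S0 : S !=set0.
  by exists y0; split => //=; rewrite -{1}(subrK x y0) nmD.
have [p pS pmin] := @compact_EVT_min _ R (fun y => nm (y - x)) S S0 cS
  (continuous_subspaceT (fun y => cvg_comp _ _ (cvgB cvg_id (cvg_cst x)) (@continuous_nm R _ (y - x)))).
move: pS; rewrite inE => -[_ pO].
have near y : nm (y - x) < nm (p - x) -> Omega y.
  move=> yp; apply: contrapT => yO; move: yp; apply/negP; rewrite -leNgt.
  have [h|h] := lerP (nm (y - x)) (nm (y0 - x)).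
    apply: pmin; rewrite inE; split => //=.
    by rewrite -{1}(subrK x y) (le_trans (nmD _ _))// lerD2r.
  apply: le_trans (ltW h); apply: pmin; rewrite inE; split => //=.
  by rewrite -{1}(subrK x y0) nmD.
exists p => //; apply/boundaryE; split => //; apply/closure_nmP => e e0.
have px0 : 0 < nm (p - x).
  by rewrite nm_gt0 subr_eq0; apply/eqP => h; apply: pO; rewrite h.
pose t := Num.min 1 (e / (2 * nm (p - x))).
have t0 : 0 < t by rewrite lt_min ltr01 divr_gt0// mulr_gt0.
have [t1 t2] : t <= 1 /\ t <= e / (2 * nm (p - x)) by split; rewrite /t ge_min lexx ?orbT.
exists (p - (t%:C%C : Cx R) *: (p - x)).
  apply: near; have -> : p - (t%:C%C : Cx R) *: (p - x) - x = ((1 - t)%:C%C : Cx R) *: (p - x).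
    have -> : (1 - t)%:C%C = 1 - t%:C%C :> Cx R by rewrite rmorphB.
    by rewrite scalerBl scale1r addrAC.
  by rewrite nmZ nm_real ger0_norm ?subr_ge0// mulrBl mul1r gtrBl mulr_gt0.
rewrite addrAC subrr add0r nmN nmZ nm_real gtr0_norm//.
move: t2; rewrite ler_pdivlMr ?mulr_gt0//; lra.
Qed.

(** If the real part vanished at y, a small step in the rotated direction of [ell_rotate] would make
    it negative inside the open set. *)
Lemma ell_strict b p : (exists w, ell b w != 0) ->
  (forall y, Omega y -> 0 <= Re (ell b (y - p))) -> forall y, Omega y -> 0 < Re (ell b (y - p)).
Proof.
move=> [w bw] H y Oy; rewrite lt_def H// andbT; apply/eqP => yz.
have [r r0 Hr] := (open_nmP _).1 openO y Oy.
have [c c1 bc] := ell_rotate b w.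
have w1 : 0 < nm w + 1 by have := nm_ge0 w; lra.
pose t := r / (nm w + 1).
have t0 : 0 < t by rewrite divr_gt0.
have := H (y + (t%:C%C : Cx R) *: (c *: w)).
have -> : y + (t%:C%C : Cx R) *: (c *: w) - p = (y - p) + (t%:C%C : Cx R) *: (c *: w) by rewrite addrAC.
rewrite ellD ellZ ReD yz add0r ReM /= mul0r subr0 bc.
have h : nm (y + (t%:C%C : Cx R) *: (c *: w) - y) < r.
  rewrite addrAC subrr add0r !nmZ c1 mul1r nm_real gtr0_norm// /t mulrAC ltr_pdivrMr//.
  by rewrite ltr_pM2l//; lra.
move=> /(_ (Hr _ h)); rewrite pmulr_rge0// oppr_ge0 leNgt nm_gt0 bw.
by [].
Qed.

(* All the constants of a C^{1,alpha} boundary point are packed into the single [e]. *)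
Definition good_point (alpha e : R) p := exists b,
  [/\ forall y, Omega y -> 0 < Re (ell b (y - p)),
      exists2 w, nm w <= 1 & e <= nm (ell b w) &
      forall v, nm v < e -> e^-1 * nm v `^ alpha * nm v < Re (ell b v) -> Omega (p + v)].

Lemma good_pointW (alpha e e' : R) p : 0 < e' -> e' <= e ->
  good_point alpha e p -> good_point alpha e' p.
Proof.
move=> e0 ee [b [H1 [w w1 H2] H3]]; exists b; split => //.
  by exists w => //; exact: le_trans H2.
move=> v ve Hv; apply: H3; first exact: lt_le_trans ee.
apply: le_lt_trans Hv; rewrite -!mulrA; apply: ler_wpM2r.
  by rewrite mulr_ge0 ?powR_ge0 ?nm_ge0.
by rewrite lef_pV2// posrE; exact: lt_le_trans ee.
Qed.

(** [b] represents minus the differential of [rho] at p. Segments from p into Omega show that it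
    supports Omega; the mean value theorem and the Hölder bound give the pinched region; continuity
    of the differential at [p0] bounds [ell b] from below. *)
Lemma good_point_local (alpha : R) p0 : 0 < alpha -> C1_holder_boundary alpha Omega -> boundary Omega p0 ->
  exists2 e : R, 0 < e & forall p, boundary Omega p -> nm (p - p0) < e -> good_point alpha e p.
Proof.
move=> al0 C1 bp0.
have [U [rho [M [[oU Up0] dU nzU HU OU]]]] := C1 p0 bp0.
have [r0 r00 Hr0] : exists2 r : R, 0 < r & forall y, nm (y - p0) < r -> U (realify y).
  have /nbhs_ballP[r /= r0 Hr] : nbhs (realify p0) U by apply: open_nbhs_nbhs.
  exists r => // y yr; apply: Hr; rewrite -ball_normE /= -realifyB.
  by apply: le_lt_trans (norm_realify _) _; rewrite nm_distC.
have [w0 w01 Hw0] : exists2 w, nm w <= 1 & 0 < `|'d rho (realify p0) (realify w)|.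
  have [v nv] := nzU _ Up0; have [w rw] := realify_surj v.
  have nw : 0 < nm w.
    rewrite nm_gt0; apply/eqP => h; move: nv; rewrite -rw h.
    have -> : realify (0 : 'rV[Cx R]_d) = 0.
      by rewrite -(subrr (0 : 'rV[Cx R]_d)) realifyB subrr.
    by rewrite linear0 eqxx.
  exists (((nm w)^-1%:C%C : Cx R) *: w).
    by rewrite nmZ nm_real ger0_norm ?invr_ge0 ?nm_ge0// mulVf// gt_eqF.
  by rewrite realifyZ linearZ normr_gt0 mulf_neq0 ?rw// invr_eq0 gt_eqF.
set c := `|'d rho (realify p0) (realify w0)| in Hw0.
(* [M] carries no sign; [N] is a positive constant above it. *)
pose N : R := `|M| + 1; have N0 : 0 < N by rewrite /N; have := normr_ge0 M; lra.
have HN x y v : U (realify x) -> U (realify y) ->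
    `|'d rho (realify x) (realify v) - 'd rho (realify y) (realify v)| <=
      N * nm (x - y) `^ alpha * nm v.
  move=> Ux Uy; apply: le_trans (HU _ _ _ Ux Uy) _; rewrite -realifyB.
  apply: (@le_trans _ _ (N * `|realify (x - y)| `^ alpha * `|realify v|)).
    do 2 (apply: ler_wpM2r; rewrite ?powR_ge0//).
    by rewrite /N; have := ler_norm M; lra.
  apply: ler_pM; rewrite ?norm_realify//; first by rewrite mulr_ge0 ?powR_ge0 ?ltW.
  rewrite ler_pM2l//; by apply: le_powR; rewrite ?norm_realify.
pose e1 := (c / (2 * N)) `^ alpha^-1.
have e10 : 0 < e1 by rewrite powR_gt0// divr_gt0// mulr_gt0.
(* r0 / 2 keeps p + v in [U]; c / 2 and [e1] leave half of the differential at [p0] when passing to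
   p; N^-1 turns the Hölder constant into e^-1. *)
pose e := Num.min (Num.min (r0 / 2) (c / 2)) (Num.min N^-1 e1).
have e0 : 0 < e by rewrite !lt_min e10 invr_gt0 N0 !divr_gt0.
have [er ec eN ee1] : [/\ e <= r0 / 2, e <= c / 2, e <= N^-1 & e <= e1].
  by split; rewrite /e !ge_min lexx ?orbT.
have eal : N * e `^ alpha <= c / 2.
  have : e `^ alpha <= e1 `^ alpha by apply: le_powR => //; exact: ltW.
  rewrite /e1 -powRrM mulVf ?gt_eqF// powRr1; last by rewrite divr_ge0 ?mulr_ge0 ?ltW.
  by rewrite ler_pdivlMr ?mulr_gt0//; lra.
exists e => // p bp pp0; have [cp nOp] := (boundaryE p).1 bp.
have Unear v : nm v < e -> U (realify (p + v)).
  move=> ve; apply: Hr0; have := nmD (p - p0) v; rewrite addrAC; lra.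
have Up : U (realify p) by have := Unear 0; rewrite addr0 nm0; apply.
(* Together with the next bound, [rho] vanishes at p: p is outside Omega, but a limit of points
   where [rho] is negative. *)
have rp_ge : 0 <= rho (realify p).
  by rewrite leNgt; apply/negP => h; apply: nOp; apply/OU.
have rp_le : rho (realify p) <= 0.
  rewrite leNgt; apply/negP => h.
  have /cvgrPdist_lt /(_ _ h) /nbhs_ballP[r /= r1 Hr] := differentiable_continuous (dU _ Up).
  have [|y Oy yp] := (closure_nmP _ _).1 cp (Num.min r e); first by rewrite lt_min r1.
  move: yp; rewrite lt_min => /andP[yr ye].
  have Uy : U (realify y) by have := Unear (y - p) ye; rewrite subrKC.
  have := (OU y Uy).1 Oy; have := Hr (realify y).
  rewrite -ball_normE /= -realifyB => /(_ _).
  have yr' : `|realify (p - y)| < r.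
    by apply: le_lt_trans (norm_realify _) _; rewrite nm_distC.
  by move=> /(_ yr'); rewrite ltr_norml => /andP[_]; lra.
have [||b Hb] := @ell_of_linear R d (fun z => - 'd rho (realify p) z).
- by move=> z z'; rewrite linearD opprD.
- by move=> t z; rewrite linearZ /= mulrN.
have bw0 : e <= nm (ell b w0).
  apply: le_trans (le_Re_nm _); rewrite Hb normrN.
  have := HN p p0 w0 Up Up0; have : nm (p - p0) `^ alpha <= e `^ alpha.
    by apply: le_powR; rewrite ?nm_ge0 ?ltW.
  move=> h1 h2.
  have h3 : N * nm (p - p0) `^ alpha * nm w0 <= c / 2.
    apply: le_trans (eal); rewrite -[X in _ <= X]mulr1; apply: ler_pM => //.
    - by rewrite mulr_ge0 ?powR_ge0 ?ltW.
    - exact: nm_ge0.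
    - by rewrite ler_pM2l.
  exact: half_close h2 h3 ec.
exists b; split; [ | by exists w0 | ].
  apply: (@ell_strict b p) => [|y Oy].
    by exists w0; rewrite -nm_gt0; lra.
  rewrite Hb oppr_ge0; apply: diff_le0; first exact: dU.
  move=> h h0; pose k := Num.min (Num.min (h / 2) 1) (e / (2 * (nm (y - p) + 1))).
  have y1 : 0 < nm (y - p) + 1 by have := nm_ge0 (y - p); lra.
  have k0 : 0 < k by rewrite !lt_min ltr01 !divr_gt0 ?mulr_gt0.
  have [k1 k2 k3] : [/\ k <= h / 2, k <= 1 & k <= e / (2 * (nm (y - p) + 1))].
    by split; rewrite /k !ge_min lexx ?orbT.
  exists k; first by rewrite k0; lra.
  rewrite -realifyZ -realifyD; apply: le_trans (ltW _) rp_ge; apply/OU.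
    apply: Unear; rewrite nmZ nm_real gtr0_norm//.
    move: k3; rewrite ler_pdivlMr ?mulr_gt0//; lra.
  by apply: closure_segment => //; rewrite k0.
move=> v ve Hv; apply/OU; first exact: Unear.
have seg (t : R) : 0 <= t <= 1 -> U (realify p + t *: realify v).
  move=> /andP[t0 t1]; rewrite -realifyZ -realifyD; apply: Unear.
  rewrite nmZ nm_real ger0_norm//; apply: le_lt_trans ve.
  by apply: ler_piMl => //; exact: nm_ge0.
have [t t01 Ht] := segment_mvt (fun t t01 => dU _ (seg t t01)).
have Ut := seg t t01; move: Ut Ht; rewrite -realifyZ -!realifyD => Ut Ht.
have := HN (p + (t%:C%C : Cx R) *: v) p v Ut Up.
have -> : nm (p + (t%:C%C : Cx R) *: v - p) = `|t| * nm v.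
  by rewrite addrAC subrr add0r nmZ nm_real.
move=> h1.
have h2 : N * (`|t| * nm v) `^ alpha * nm v <= e^-1 * nm v `^ alpha * nm v.
  apply: ler_wpM2r; first exact: nm_ge0.
  apply: ler_pM; rewrite ?powR_ge0 ?(ltW N0)//.
    by rewrite -[leLHS]invrK lef_pV2 ?posrE ?invr_gt0.
  apply: le_powR; rewrite ?mulr_ge0 ?nm_ge0//.
  move: t01 => /andP[t0 t1]; rewrite ger0_norm//.
  by apply: ler_piMl => //; exact: nm_ge0.
rewrite Hb in Hv.
exact: increment_lt0 Ht rp_le h1 h2 Hv.
Qed.

End ConvexDomain.

Lemma ell_continuous (R : realType) (d : nat) (T : topologicalType)
    (f g : T -> 'rV[Cx R]_d) :
  continuous f -> continuous g -> continuous (fun t => ell (f t) (g t)).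
Proof.
move=> cf cg; rewrite (_ : (fun t => _) = (fun t => \sum_j g t ord0 j * f t ord0 j)); last first.
  by apply/funext => t; rewrite ellE.
apply: continuous_big => [|j _ t]; first exact: add_continuous.
apply: cvgM.
  apply: (@continuous_comp _ _ _ g (fun v : 'rV[Cx R]_d => v ord0 j)); first exact: cg.
  exact: coord_continuous.
apply: (@continuous_comp _ _ _ f (fun v : 'rV[Cx R]_d => v ord0 j)); first exact: cf.
exact: coord_continuous.
Qed.

Lemma Re_continuous (R : realType) : continuous (fun z : Cx R => complex.Re z : R^o).
Proof.
move=> z A /nbhs_ballP[e e0 sA].
apply: (nbhs_nmP (z : Cx R) [set u : Cx R | A (complex.Re u)]).2.
exists e => // u uz; apply: sA; rewrite /ball /= distrC.
by apply: le_lt_trans uz; rewrite -ReN -ReD le_Re_nm.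
Qed.

(** * Estimates uniform over the boundary of a bounded domain *)

Section BoundedDomain.
Variables (R : realType) (d : nat) (Omega : set 'rV[Cx R]_d) (alpha B : R).
Implicit Types (p q x y v w b o : 'rV[Cx R]_d).
Local Notation Re := complex.Re.
Local Notation Im := complex.Im.
Hypothesis d0 : (0 < d)%N.
Hypothesis al0 : 0 < alpha.
Hypothesis openO : open Omega.
Hypothesis convO : convex_set Omega.
Hypothesis boundO : forall y, Omega y -> nm y <= B.
Hypothesis C1O : C1_holder_boundary alpha Omega.

Lemma closure_bounded y : closure Omega y -> nm y <= B.
Proof.
move=> cy; rewrite leNgt; apply/negP => lt.
have [|q Oq qy] := (closure_nmP _ _).1 cy (nm y - B); first by rewrite subr_gt0.
by have := boundO Oq; have := nmBB y q; rewrite nm_distC ler_norml => /andP[]; lra.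
Qed.

Lemma bound_ge0 o : Omega o -> 0 <= B.
Proof. by move=> /boundO; apply: le_trans; exact: nm_ge0. Qed.

Lemma compact_closure_domain : compact (closure Omega).
Proof.
have [[x /bound_ge0 B0]|nO] := pselect (exists x, Omega x).
  apply: subclosed_compact (compact_nm_ball B0) _; first exact: closed_closure.
  exact: closure_bounded.
have -> : Omega = set0.
  by apply/seteqP; split => // y Oy; apply: nO; exists y.
by rewrite closure0; exact: compact0.
Qed.

Lemma compact_boundary : compact (boundary Omega).
Proof.
have -> : boundary Omega = closure Omega `&` ~` Omega.
  by apply/seteqP; split => p /(boundaryE openO).
by apply: compact_closedI; [exact: compact_closure_domain | exact: open_closedC].
Qed.

(** By [good_pointW] a smaller positive [e] is always allowed, so the near-covering form of
    compactness, used with the filter of small positive reals, merges the local constants. *)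
Lemma good_point_uniform : exists2 e : R, 0 < e &
  forall p, boundary Omega p -> good_point Omega alpha e p.
Proof.
have FF : Filter (0^'+ : set_system R) by typeclasses eauto.
have cover p : boundary Omega p -> \forall q \near p & h \near (0 : R)^'+,
    (boundary Omega q -> good_point Omega alpha h q).
  move=> bp; have [e e0 He] := good_point_local openO convO al0 C1O bp.
  exists ([set q | nm (q - p) < e], [set h | 0 < h /\ h < e]).
    split; first by apply/nbhs_nmP; exists e.
    by apply: filterI; [exact: nbhs_right_gt | exact: nbhs_right_lt].
  move=> [q h] [/= qp [h0 he]] bq; apply: good_pointW h0 (ltW he) _.
  exact: He.
have K := (compact_near_coveringP _).1 compact_boundary R (0^'+) _ FF cover.
have PF : ProperFilter (0^'+ : set_system R) by typeclasses eauto.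
have [e [He e0]] := @filter_ex _ _ PF _ (filterI K (nbhs_right_gt (0 : R))).
by exists e => // p bp; exact: (He p bp bp).
Qed.

(* Touching the domain by the ball about [x] from inside forces the value of the
   supporting functional at [x - p] to be real and equal to its norm times [nm (p - x)]. *)
Lemma supporting_functional (e : R) x p : 0 < e -> Omega x -> ~ Omega p ->
  (forall y, nm (y - x) < nm (p - x) -> Omega y) -> good_point Omega alpha e p ->
  exists b, [/\ forall v, nm (ell b v) <= nm v,
     ell b (x - p) = (nm (p - x))%:C%C,
     forall y, Omega y -> 0 < Re (ell b (y - p)) &
     forall v, nm v < e -> e^-1 ^+ 2 * nm v `^ alpha * nm v < Re (ell b v) -> Omega (p + v)].
Proof.
move=> e0 Ox nOp near [b [H1 [w w1 H2] H3]].
set r := nm (p - x).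
have r0 : 0 < r.
  by rewrite nm_gt0 subr_eq0; apply/eqP => h; apply: nOp; rewrite h.
set m := Re (ell b (x - p)); have m0 : 0 < m by exact: H1.
(* Otherwise moving from x by m / |ell b v| times the rotated v stays within the ball about x and
   reaches a point of Omega where the real part is 0. *)
have dual v : nm (ell b v) * r <= m * nm v.
  rewrite leNgt; apply/negP => lt.
  have a0 : 0 < nm (ell b v).
    rewrite lt_def nm_ge0 andbT; apply/eqP => h; move: lt; rewrite h mul0r ltNge.
    by rewrite mulr_ge0 ?nm_ge0// ltW.
  have [c c1 bc] := ell_rotate b v.
  pose t := m / nm (ell b v); have t0 : 0 < t by rewrite divr_gt0.
  pose y := x + (t%:C%C : Cx R) *: (c *: v).
  have yx : y - x = (t%:C%C : Cx R) *: (c *: v) by rewrite /y addrAC subrr add0r.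
  have Oy : Omega y.
    apply: near; rewrite yx !nmZ c1 mul1r nm_real gtr0_norm// /t mulrAC ltr_pdivrMr//.
    by rewrite [X in _ < X]mulrC.
  have := H1 y Oy; have -> : y - p = (x - p) + (t%:C%C : Cx R) *: (c *: v) by rewrite /y addrAC.
  rewrite ellD ellZ ReD ReM /= mul0r subr0 bc -/m /t mulrN divfK ?gt_eqF// subrr.
  by rewrite ltxx.
pose l := m / r; have l0 : 0 < l by rewrite divr_gt0.
have dual' v : nm (ell b v) <= l * nm v.
  by rewrite /l mulrAC ler_pdivlMr.
have real : ell b (x - p) = m%:C%C.
  apply: eqC => //=.
  have h : nm (ell b (x - p)) <= m.
    have := dual (x - p); rewrite [nm (x - p)]nm_distC -/r ler_pM2r//.
  have := nm_leX2 (ell b (x - p)) (ltW m0); rewrite h => /esym.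
  rewrite -/m gerDl => h2; apply/eqP; rewrite -sqrf_eq0 eq_le h2 sqr_ge0.
  by [].
(* [l] is the norm of the form, about to be divided out. Since l >= e, the pinching constant e^-1
   becomes at worst e^-2. *)
have el : e <= l.
  apply: le_trans H2 _; apply: le_trans (dual' w) _.
  by rewrite -[X in _ <= X]mulr1 ler_pM2l.
pose li : Cx R := (l^-1)%:C%C.
have Reli z : Re (li * z) = l^-1 * Re z by rewrite ReM /= mul0r subr0.
exists (li *: b); split.
- move=> v; rewrite ellZl nmM nm_real gtr0_norm ?invr_gt0//.
  by rewrite mulrC ler_pdivrMr// mulrC.
- rewrite ellZl real /li -realCM; congr (_%:C)%C.
  by rewrite /l invf_div divfK ?gt_eqF.
- by move=> y Oy; rewrite ellZl Reli mulr_gt0 ?invr_gt0 ?H1.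
- move=> v ve; rewrite ellZl Reli => Hv; apply: H3 => //.
  have X0 : 0 <= nm v `^ alpha * nm v by rewrite mulr_ge0 ?powR_ge0 ?nm_ge0.
  have : l * (e^-1 ^+ 2 * nm v `^ alpha * nm v) < Re (ell b v).
    by rewrite -ltr_pdivlMl.
  apply: le_lt_trans.
  have -> : l * (e^-1 ^+ 2 * nm v `^ alpha * nm v) =
      (l * e^-1) * (e^-1 * nm v `^ alpha * nm v) by ring.
  apply: ler_peMl; last by rewrite ler_pdivlMr// mul1r.
  by rewrite -mulrA mulr_ge0// invr_ge0 ltW.
Qed.

(** The pinched chain ends at a point surrounded by a ball whose radius does not depend on p, from
    which [chain_le_balls] reaches the base point at uniform cost. *)
Lemma inner_ball (e t : R) b p n : (forall v, nm (ell b v) <= nm v) ->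
  (forall v, nm v < e -> e^-1 ^+ 2 * nm v `^ alpha * nm v < Re (ell b v) -> Omega (p + v)) ->
  nm n = 1 -> ell b n = 1 -> 0 < t -> 2 * t < e ->
  e^-1 ^+ 2 * (2 * t) `^ alpha * (2 * t) <= t / 4 ->
  forall z, nm (z - (p + (t%:C%C : Cx R) *: n)) < t / 2 -> Omega z.
Proof.
move=> b1 b4 nn bn t0 te tK z; set w := z - _ => wt.
have -> : z = p + ((t%:C%C : Cx R) *: n + w) by rewrite addrA subrKC.
set v := _ *: n + w; have v1 : nm v <= 2 * t.
  by have := nmD ((t%:C%C : Cx R) *: n) w; rewrite nmZ nn nm_real gtr0_norm// -/v; lra.
apply: b4; first exact: le_lt_trans te.
have h1 : t / 2 <= Re (ell b v).
  rewrite ellD ellZ bn mulr1 ReD /=.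
  have := le_Re_nm (ell b w); have := b1 w.
  by rewrite ler_norml => ? /andP[]; lra.
apply: (@le_lt_trans _ _ (t / 4)); last by lra.
apply: le_trans tK; apply: ler_pM => //.
- by rewrite mulr_ge0 ?powR_ge0 ?sqr_ge0.
- exact: nm_ge0.
- by apply: ler_wpM2l; [exact: sqr_ge0 | apply: le_powR => //; exact: nm_ge0].
Qed.

Lemma boundary_data o : Omega o -> exists C : R, forall x, Omega x -> exists p b,
  [/\ boundary Omega p, forall v, nm (ell b v) <= nm v,
     0 < nm (p - x) /\ ell b (x - p) = (nm (p - x))%:C%C,
     forall y, Omega y -> 0 < Re (ell b (y - p)) &
     chain_le Omega x o (ln (nm (p - x))^-1 / 2 + C)].
Proof.
move=> Oo; have B0 := bound_ge0 Oo.
have [e e0 He] := good_point_uniform.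
have [||t [t0 tr tK] Ht] := @chain_le_pinched R d Omega alpha (e^-1 ^+ 2) e al0.
- by rewrite exprn_gt0// invr_gt0.
- by [].
have [r r0 Hr] := (open_nmP _).1 openO o Oo.
pose k := Num.min (t / 2) r.
have k0 : 0 < k by rewrite lt_min divr_gt0.
have [kt kr] : k <= t / 2 /\ k <= r by split; rewrite /k ge_min lexx ?orbT.
have [C HC] := chain_le_balls convO (2 * B) k0.
(* For delta <= t the cost is that of the pinched chain plus [C]. For delta > t the ball about x
   already has radius at least k, and ln (2 B + 1) offsets a possibly negative ln (1 / delta). *)
exists (`|ln t| / 2 + 1 + C + `|ln (2 * B + 1)| / 2) => x Ox.
have oxB z : Omega z -> nm (o - z) <= 2 * B.
  by move=> Oz; have := nmB o z; have := boundO Oo; have := boundO Oz; lra.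
have ball_o z : nm (z - o) < k -> Omega z by move=> zo; apply: Hr; exact: lt_le_trans kr.
have [p bp near] := nearest_boundary_point openO d0 boundO Ox.
have nOp := ((boundaryE openO p).1 bp).2.
have [b [b1 b2 b3 b4]] := supporting_functional e0 Ox nOp near (He p bp).
exists p, b; set s := nm (p - x).
have s0 : 0 < s.
  by rewrite nm_gt0 subr_eq0; apply/eqP => h; apply: nOp; rewrite h.
split => //.
have lt0 := ler_norm (ln t); have lt1 := normr_ge0 (ln t).
have lB0 := ler_norm (ln (2 * B + 1)); have lB1 := normr_ge0 (ln (2 * B + 1)).
have lns : ln s^-1 = - ln s by rewrite lnV// posrE.
have [st|ts] := lerP s t; last first.
  have sB : ln s <= ln (2 * B + 1).
    rewrite ler_ln ?posrE//; last by lra.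
    have := nmB p x; have := boundO Ox; have := closure_bounded ((boundaryE openO p).1 bp).1.
    by rewrite -/s; lra.
  apply: chain_le_weak (HC x o (oxB x Ox) _ ball_o); first by rewrite lns; lra.
  by move=> z zx; apply: near; rewrite -/s; lra.
(* The unit vector from p to x, where the form takes the value 1. Along p + z n the pinched region
   is exactly Re z > K |z|^(1+alpha), with x at parameter s. *)
pose n := ((s^-1)%:C%C : Cx R) *: (x - p).
have nn : nm n = 1.
  by rewrite /n nmZ nm_real gtr0_norm ?invr_gt0// nm_distC -/s mulVf// gt_eqF.
have bn : ell b n = 1.
  by rewrite /n ellZ b2 -realCM mulVf ?gt_eqF.
have xE : x = p + (s%:C%C : Cx R) *: n.
  by rewrite /n scalerA -realCM mulfV ?gt_eqF// scale1r subrKC.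
pose y := p + (t%:C%C : Cx R) *: n.
have ball_y z : nm (z - y) < k -> Omega z.
  by move=> zy; apply: (inner_ball b1 b4 nn bn t0 tr tK); exact: lt_le_trans kt.
have yO : Omega y by apply: ball_y; rewrite subrr nm0.
have step : chain_le Omega x y (ln (t / s) / 2 + 1).
  rewrite {1}xE; apply: Ht; last by rewrite s0.
  move=> z ze Hz; apply: b4; rewrite nmZ nn mulr1// ellZ bn mulr1.
  by [].
apply: chain_le_weak (chain_le_trans step (HC y o (oxB y yO) ball_y ball_o)).
rewrite ln_div ?posrE// lns; lra.
Qed.

Lemma ell_delta b j : ell b (delta_mx ord0 j) = b ord0 j.
Proof.
rewrite ellE (bigD1 j)//= big1 => [|i ij]; first by rewrite mxE !eqxx mul1r addr0.
by rewrite mxE (negbTE ij) andbF mul0r.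
Qed.

Lemma ell_neq0 b : b != 0 -> exists w, ell b w != 0.
Proof.
move=> bn0; apply: contrapT => nex; move/eqP: bn0; apply; apply/rowP => j; rewrite [RHS]mxE.
apply: contrapT => bj; apply: nex; exists (delta_mx ord0 j); rewrite ell_delta.
exact/eqP.
Qed.

(** Positivity keeps the complex hyperplane through p off Omega, so it is supporting; y lies on it
    and in the boundary, where only one point is allowed. *)
Lemma touching_point b p y : C_strictly_convex Omega -> boundary Omega p -> b != 0 ->
  (forall z, Omega z -> 0 < Re (ell b (z - p))) -> closure Omega y ->
  ell b (y - p) = 0 -> y = p.
Proof.
move=> [_ Csc] bp bn0 pos cy h.
pose H : set 'rV[Cx R]_d := [set z | (z *m b^T) ord0 ord0 = ell b p].
have Hy : H y by move/eqP: h; rewrite ellB subr_eq0 => /eqP.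
have HO z : H z -> ~ Omega z.
  move=> Hz Oz; have := pos z Oz; rewrite ellB.
  by have -> : ell b z = ell b p by []; rewrite subrr /= ltxx.
have [|q Hq] := Csc H.
  split.
  - by exists b^T, (ell b p); split => //; rewrite trmx_eq0.
  - by exists p.
  - by apply/seteqP; split => // z [/HO].
have pq : (H `&` boundary Omega) p by [].
have yq : (H `&` boundary Omega) y.
  exact: (conj Hy ((boundaryE openO y).2 (conj cy (HO y Hy)))).
by move: pq yq; rewrite Hq /= => -> ->.
Qed.

(** |ell b (y - p)| attains its minimum over the compact set of triples (b, p, y) with |y - p| >= e,
    and [touching_point] makes that minimum positive. Positivity on Omega is relaxed to a closed
    condition, and [ell_strict] restores it at the minimiser. *)
Lemma strict_modulus (e : R) : C_strictly_convex Omega -> 0 < e ->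
  exists2 h : R, 0 < h & forall p b y n, boundary Omega p ->
    (forall v, nm (ell b v) <= nm v) -> 0 < nm n <= nm (ell b n) ->
    (forall z, Omega z -> 0 < Re (ell b (z - p))) -> closure Omega y ->
    nm (ell b (y - p)) < h -> nm (y - p) < e.
Proof.
move=> Csc e0; pose W := ('rV[Cx R]_d * ('rV[Cx R]_d * 'rV[Cx R]_d))%type.
have cb : continuous (fun t : W => t.1) by move=> t; exact: cvg_fst.
have cp : continuous (fun t : W => t.2.1).
  by move=> t; apply: (cvg_comp _ _ cvg_snd); exact: cvg_fst.
have cy : continuous (fun t : W => t.2.2).
  by move=> t; apply: (cvg_comp _ _ cvg_snd); exact: cvg_snd.
have cyp : continuous (fun t : W => t.2.2 - t.2.1).
  by move=> t; apply: cvgB; [exact: cy | exact: cp].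
have czp z : continuous (fun t : W => z - t.2.1).
  by move=> t; apply: cvgB; [exact: cvg_cst | exact: cp].
pose box : set W := [set b | nm b <= 1] `*` (boundary Omega `*` closure Omega).
(* Keeps b away from 0; it follows from |n| <= |ell b n| <= d |b| |n|. *)
pose F1 : set W := (fun t : W => nm t.1 : R^o) @^-1` [set a | d%:R^-1 <= a].
pose F2 : set W := (fun t : W => nm (t.2.2 - t.2.1) : R^o) @^-1` [set a | e <= a].
pose F3 z : set W := (fun t : W => Re (ell t.1 (z - t.2.1)) : R^o) @^-1` [set a | 0 <= a].
pose S := box `&` (F1 `&` (F2 `&` \bigcap_(z in Omega) F3 z)).
have cF1 : closed F1.
  apply: preimage_closed; last exact: closed_ge.
  by move=> t _; apply: (continuous_comp (cb t)); exact: continuous_nm.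
have cF2 : closed F2.
  apply: preimage_closed; last exact: closed_ge.
  by move=> t _; apply: (continuous_comp (cyp t)); exact: continuous_nm.
have cF3 z : closed (F3 z).
  apply: preimage_closed; last exact: closed_ge.
  move=> t _; apply: (@continuous_comp _ _ _ (fun t : W => ell t.1 (z - t.2.1)) (fun c : Cx R => Re c : R^o)); last exact: Re_continuous.
  by apply: ell_continuous; [exact: cb | exact: czp].
have cS : compact S.
  apply: compact_closedI.
    apply: compact_setX; first exact: compact_nm_ball.
    by apply: compact_setX; [exact: compact_boundary | exact: compact_closure_domain].
  apply: closedI => //; apply: closedI => //.
  by apply: closed_bigI => z _.
have dR : 0 < d%:R :> R by rewrite ltr0n.
have inS p b y n : boundary Omega p -> (forall v, nm (ell b v) <= nm v) ->
    0 < nm n <= nm (ell b n) -> (forall z, Omega z -> 0 < Re (ell b (z - p))) ->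
    closure Omega y -> e <= nm (y - p) -> S (b, (p, y)).
  move=> bp b1 /andP[n0 nb] b3 cyy eyp; split; split => //=.
  - apply: nm_le_coord => // j.
    rewrite -ell_delta.
    apply: le_trans (b1 _) _; apply: nm_le_coord => // i.
    by rewrite mxE; case: (_ && _); rewrite ?nm1 ?nm0.
  - rewrite /F1 /= -div1r ler_pdivrMr//.
    have := le_trans nb (nm_ell b n); rewrite mulrA -{1}[nm n]mul1r ler_pM2r// mulrC.
    by [].
  - by split => // z Oz; exact: ltW (b3 z Oz).
have [S0|nS] := pselect (S !=set0); last first.
  exists 1; first exact: ltr01.
  move=> p b y n bp b1 bn b3 cyy _.
  case: (ltP (nm (y - p)) e) => [lt|eyp]; first by [].
  by exfalso; apply: nS; exists (b, (p, y)); exact: inS b1 bn b3 cyy eyp.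
have cPhi : continuous (fun t : W => nm (ell t.1 (t.2.2 - t.2.1)) : R^o).
  move=> t; apply: (@continuous_comp _ _ _ (fun t : W => ell t.1 (t.2.2 - t.2.1)) (fun c : Cx R => nm c : R^o)); last exact: continuous_nm.
  by apply: ell_continuous; [exact: cb | exact: cyp].
have [[b [p y]] bS bmin] := compact_EVT_min S0 cS (continuous_subspaceT cPhi).
move: bS; rewrite inE => -[[/= b1 [bp cyy]] [F1b [F2b F3b]]].
have h0 : 0 < nm (ell b (y - p)).
  rewrite lt_def nm_ge0 andbT; apply/eqP => h.
  have bn0 : b != 0 by rewrite -nm_gt0; apply: lt_le_trans F1b; rewrite invr_gt0.
  have pos := ell_strict openO (ell_neq0 bn0) F3b.
  have z0 : ell b (y - p) = 0 by move/eqP: h; rewrite nm_eq0 => /eqP.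
  have yp := touching_point Csc bp bn0 pos cyy z0.
  by move: F2b; rewrite /F2 /= yp subrr nm0 leNgt e0.
exists (nm (ell b (y - p))); first exact: h0.
move=> p' b' y' n' bp' b1' bn' b3' cyy' lt.
case: (ltP (nm (y' - p')) e) => [lt'|eyp]; first by [].
exfalso; move: lt; apply/negP; rewrite -leNgt.
by apply: (bmin (b', (p', y'))); rewrite inE; exact: inS b1' bn' b3' cyy' eyp.
Qed.

End BoundedDomain.

Lemma bounded_set_nm (R : realType) (V : normedModType (Cx R)) (A : set V) :
  bounded_set A -> exists B : R, forall y, A y -> nm y <= B.
Proof.
move=> [M [Mreal H]]; exists (complex.Re M + 1) => y Ay.
rewrite -lecR -normE; apply: H => //.
rewrite ltcE /= ltrDl ltr01 andbT; apply/eqP.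
move: Mreal; rewrite realE => /orP[/ger0_Im ->//|].
by rewrite -oppr_ge0 => /ger0_Im; rewrite ImN => /eqP; rewrite oppr_eq0 => /eqP ->.
Qed.

Lemma ell_derivable (R : realType) (d : nat) (b p : 'rV[Cx R]_d)
    (f : Cx R -> 'rV[Cx R]_d) (z : Cx R) :
  derivable f z 1 -> derivable (fun u => ell b (f u - p)) z 1.
Proof.
move=> /cvg_ex[l Hl]; apply/cvg_ex; exists (ell b l).
rewrite (_ : (fun h : Cx R => _) =
    ell b \o (fun h : Cx R => h^-1 *: ((f \o shift z) (h *: 1) - f z))); last first.
  apply/funext => h /=; rewrite ellZ; congr (_ * _).
  by rewrite !ellB; ring.
apply: (cvg_comp _ _ Hl).
have cb : continuous (ell b).
  by apply: (@ell_continuous R d _ (fun=> b) id); [exact: cst_continuous | move=> t; exact: cvg_id].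
exact: cb.
Qed.

(** Re g(z) <= C (1 - |z|) <= C (1 - |z|^2) cancels the factor at z in Schwarz-Pick. With |u - z| <=
    2 h and 1 - |u|^2 >= h, a single power of h survives. *)
Lemma increment_bound (R : realType) (g : Cx R -> Cx R) (C M h : R) (z u : Cx R) :
  (forall w, nm w < 1 -> derivable g w 1) ->
  (forall w, nm w < 1 -> 0 < complex.Re (g w)) ->
  0 <= C -> nm z < 1 -> 0 < h <= 1 - nm u ->
  complex.Re (g z) <= C * (1 - nm z) -> complex.Re (g u) <= M -> nm (u - z) <= 2 * h ->
  nm (g u - g z) ^+ 2 <= 16 * C * M * h.
Proof.
move=> gd gpos C0 z1 /andP[h0 uh] gz gu uz.
have u1 : nm u < 1 by lra.
have sp := schwarz_pick gd gpos z1 u1.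
have gz0 := gpos z z1; have gu0 := gpos u u1.
pose P := 1 - nm z ^+ 2; pose Q := 1 - nm u ^+ 2.
have sub_sqr (t : R) : 0 <= t -> t < 1 -> 1 - t <= 1 - t ^+ 2.
  by move=> t0 t1; rewrite lerD2l lerN2 expr2 ler_piMl// ltW.
have zP : 1 - nm z <= P := sub_sqr _ (nm_ge0 z) z1.
have uQ : h <= Q := le_trans uh (sub_sqr _ (nm_ge0 u) u1).
have P0 : 0 < P by apply: lt_le_trans zP; rewrite subr_gt0.
have r1 : 4 * complex.Re (g z) * complex.Re (g u) * nm (u - z) ^+ 2 <=
    4 * (C * P) * M * (2 * h) ^+ 2.
  apply: ler_pM.
  - by apply: mulr_ge0; [apply: mulr_ge0 => //; exact: ltW | exact: ltW].
  - exact: sqr_ge0.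
  - apply: ler_pM => //; [apply: mulr_ge0 => //; exact: ltW | exact: ltW |].
    by rewrite ler_pM2l//; apply: le_trans gz _; exact: ler_wpM2l.
  - by apply: lerXn2r; rewrite ?nnegrE ?nm_ge0// mulr_ge0// ltW.
have r2 : nm (g u - g z) ^+ 2 * (P * h) <= nm (g u - g z) ^+ 2 * (P * Q).
  by apply: ler_wpM2l; [exact: sqr_ge0 | rewrite ler_pM2l].
have Ph : 0 < P * h by rewrite mulr_gt0.
rewrite -(ler_pM2r Ph); apply: le_trans r2 (le_trans sp (le_trans r1 _)).
by rewrite le_eqVlt; apply/orP; left; apply/eqP; ring.
Qed.

(** * Boundary behaviour of geodesics *)

Section Geodesic.
Variables (R : realType) (d : nat) (Omega : set 'rV[Cx R]_d) (alpha B : R).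
Implicit Types (p y b : 'rV[Cx R]_d) (z u w : Cx R).
Local Notation Re := complex.Re.
Local Notation Im := complex.Im.
Hypothesis d0 : (0 < d)%N.
Hypothesis al0 : 0 < alpha.
Hypothesis openO : open Omega.
Hypothesis CscO : C_strictly_convex Omega.
Hypothesis boundO : forall y, Omega y -> nm y <= B.
Hypothesis C1O : C1_holder_boundary alpha Omega.
Variable phi : Cx R -> 'rV[Cx R]_d.
Hypothesis geo : complex_geodesic Omega phi.

Lemma geodesic_in z : nm z < 1 -> Omega (phi z).
Proof. by move=> /unit_discE z1; have [] := geo.1 z z1. Qed.

Lemma geodesic_derivable z : nm z < 1 -> derivable phi z 1.
Proof. by move=> /unit_discE z1; have [] := geo.1 z z1. Qed.

Lemma geodesic_continuous z : nm z < 1 -> {for z, continuous phi}.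
Proof.
by move=> z1; apply: differentiable_continuous; apply/derivable1_diffP; exact: geodesic_derivable.
Qed.

Lemma poincare_dist0 z : poincare_dist z 0 = artanh (nm z).
Proof.
rewrite /poincare_dist -nmE subr0 (_ : (0 : Cx R)^* = 0) ?mulr0 ?subr0 ?divr1//.
by rewrite rmorph0.
Qed.

(** Along a geodesic the distance to phi(0) is ln ((1 + |z|) / (1 - |z|)) / 2, and the chains bound
    it by ln (1 / delta) / 2 + C. The factors 1/2 agree, so exponentiating gives linear decay with
    constant exp (2 C). *)
Lemma geodesic_boundary_data : exists2 C : R, 0 < C & forall z, nm z < 1 -> exists p b,
  [/\ boundary Omega p, forall v, nm (ell b v) <= nm v,
     0 < nm (p - phi z) <= C * (1 - nm z) /\ ell b (phi z - p) = (nm (p - phi z))%:C%C &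
     forall y, Omega y -> 0 < Re (ell b (y - p))].
Proof.
have nm00 : nm (0 : Cx R) < 1 by rewrite nm0.
have [C HC] := boundary_data d0 al0 openO CscO.1 boundO C1O (geodesic_in nm00).
exists (expR (2 * C)); first exact: expR_gt0.
move=> z z1; have [p [b [bp b1 [s0 b2] b3 ch]]] := HC _ (geodesic_in z1).
exists p, b; split => //; split => //; rewrite s0 /=.
have := kobayashi_le ch; rewrite (geo.2 z 0); try exact/unit_discE.
rewrite lee_fin poincare_dist0 /artanh.
set s := nm (p - phi z) in s0 *; set t := nm z in z1 * => h.
have t0 : 0 <= t by exact: nm_ge0.
have : ln ((1 + t) / (1 - t)) <= ln (s^-1 * expR (2 * C)).
  have E : ln (s^-1 * expR (2 * C)) = ln s^-1 + 2 * C.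
    by rewrite lnM ?posrE ?expR_gt0 ?invr_gt0// expRK.
  by rewrite E; lra.
rewrite ler_ln ?posrE ?mulr_gt0 ?expR_gt0 ?invr_gt0//; try lra.
rewrite ler_pdivrMr ?subr_gt0// mulrAC -mulrA ler_pdivlMl// => h'.
have : s * 1 <= s * (1 + t) by apply: ler_wpM2l; [exact: ltW | lra].
by lra.
Qed.

Lemma geodesic_near_circle (e : R) : 0 < e -> exists2 h : R, 0 < h < 1 & forall z u,
  nm z < 1 -> 1 - nm z <= h -> h <= 1 - nm u -> nm (u - z) <= 2 * h ->
  nm (phi u - phi z) < e.
Proof.
move=> e0; have [C C0 HC] := geodesic_boundary_data.
have B0 : 0 <= B.
  by apply: (bound_ge0 boundO (o := phi 0)); apply: geodesic_in; rewrite nm0.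
have e2 : 0 < e / 2 by rewrite divr_gt0.
have [eta eta0 Heta] := strict_modulus d0 openO boundO CscO e2.
have M0 : 0 < 32 * B * C + 1.
  have BC : 0 <= B * C by apply: mulr_ge0 => //; exact: ltW.
  by rewrite -mulrA; lra.
(* The bound with eta^2 gives |g(u) - g(z)| < eta / 2; those with C give |g(z)| <= eta / 2 and
   |phi(z) - p| <= e / 2. *)
pose h := Num.min (Num.min (1 / 2) (eta ^+ 2 / (8 * (32 * B * C + 1))))
                  (Num.min (eta / (4 * C)) (e / (4 * C))).
have h0 : 0 < h by rewrite !lt_min !divr_gt0 ?mulr_gt0 ?exprn_gt0.
have [h1 h2 h3 h4] : [/\ h <= 1 / 2, h <= eta ^+ 2 / (8 * (32 * B * C + 1)),
    h <= eta / (4 * C) & h <= e / (4 * C)] by split; rewrite /h !ge_min lexx ?orbT.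
clearbody h.
exists h; first by rewrite h0; lra.
have Ch3 : C * h <= eta / 2 by move: h3; rewrite ler_pdivlMr ?mulr_gt0//; lra.
have Ch4 : C * h <= e / 2 by move: h4; rewrite ler_pdivlMr ?mulr_gt0//; lra.
have Xh : 16 * C * (2 * B) * h < (eta / 2) ^+ 2.
  move: h2; rewrite ler_pdivlMr ?mulr_gt0// => h2.
  by have := exprn_gt0 2 eta0; rewrite expr_div_n; lra.
clear h1 h2 h3 h4 M0.
move=> z u z1 zh uh uz.
have u1 : nm u < 1 by lra.
have [p [b [bp b1 [/andP[s0 sC] b2] b3]]] := HC z z1.
set s := nm (p - phi z) in s0 sC b2.
pose g w := ell b (phi w - p).
have gd w : nm w < 1 -> derivable g w 1.
  by move=> w1; apply: ell_derivable; exact: geodesic_derivable.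
have gpos w : nm w < 1 -> 0 < Re (g w) by move=> w1; apply: b3; exact: geodesic_in.
have gz : Re (g z) = s by rewrite /g b2.
have gu : Re (g u) <= 2 * B.
  apply: le_trans (ler_norm _) (le_trans (le_Re_nm _) (le_trans (b1 _) _)).
  have := nmB (phi u) p; have := boundO (geodesic_in u1).
  by have := closure_bounded boundO ((boundaryE openO p).1 bp).1; lra.
have sh : s <= C * h by apply: le_trans sC _; rewrite ler_pM2l.
have X : nm (g u - g z) ^+ 2 <= 16 * C * (2 * B) * h.
  have gzC : Re (g z) <= C * (1 - nm z) by rewrite gz.
  by apply: (increment_bound gd gpos (ltW C0) z1 _ gzC gu uz); rewrite h0.
have X2 : nm (g u - g z) < eta / 2.
  rewrite -(ltr_pXn2r (n := 2)) ?nnegrE ?nm_ge0 ?divr_ge0 ?(ltW eta0)//.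
  exact: le_lt_trans X Xh.
have gzn : nm (g z) = s by rewrite /g b2 nm_real gtr0_norm.
have gue : nm (g u) < eta.
  rewrite -(subrK (g z) (g u)) [eta]splitr; apply: le_lt_trans (nmD _ _) _.
  by rewrite gzn; apply: ltr_leD X2 (le_trans sh Ch3).
have un : 0 < nm (phi z - p) <= nm (ell b (phi z - p)).
  by rewrite b2 nm_real [nm (phi z - p)]nm_distC -/s gtr0_norm// s0 lexx.
rewrite [e]splitr; apply: le_lt_trans (nm_triangle p _ _) _; apply: ltr_leD.
  exact: Heta bp b1 un b3 (subset_closure (geodesic_in u1)) gue.
exact: le_trans sh Ch4.
Qed.

(** Heine's argument on the closed disc of radius r, with w left free in the whole open disc so that
    mixed pairs are covered. *)
Lemma geodesic_uniform_inside (r e : R) : r < 1 -> 0 < e -> exists2 h : R, 0 < h &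
  forall z w, nm z <= r -> nm w < 1 -> nm (w - z) < h -> nm (phi w - phi z) < e.
Proof.
move=> r1 e0.
have FF : Filter (0^'+ : set_system R) by typeclasses eauto.
have PF : ProperFilter (0^'+ : set_system R) by typeclasses eauto.
have cover z : [set z : Cx R | nm z <= r] z -> \forall q \near z & h \near (0 : R)^'+,
    (forall w, nm w < 1 -> nm (w - q) < h -> nm (phi w - phi q) < e).
  move=> /= zr; have z1 : nm z < 1 by lra.
  have [|k k0 Hk] := (continuous_nmP _ _).1 (geodesic_continuous z1) (e / 2).
    by rewrite divr_gt0.
  exists ([set q | nm (q - z) < k / 2], [set h | h < k / 2]).
    split; first by apply: (nbhs_nmP (z : Cx R) [set q : Cx R | nm (q - z) < k / 2]).2;
      exists (k / 2); rewrite ?divr_gt0.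
    by apply: nbhs_right_lt; rewrite divr_gt0.
  move=> [q h] [/= qz hk] w w1 wq.
  have wz : nm ((w : Cx R) - z) < k by have := nm_triangle (q : Cx R) w z; lra.
  have qz' : nm ((q : Cx R) - z) < k by lra.
  have := Hk w wz; have := Hk q qz'; have := nm_triangle (phi z) (phi w) (phi q).
  by rewrite (nm_distC (phi z)); lra.
have K := (compact_near_coveringP _).1 (@compact_disc R r) R (0^'+) _ FF cover.
have [h [Hh h0]] := @filter_ex _ _ PF _ (filterI K (nbhs_right_gt (0 : R))).
by exists h => // z w zr; exact: Hh.
Qed.

Lemma geodesic_uniform (e : R) : 0 < e -> exists2 h : R, 0 < h &
  forall z w, nm z < 1 -> nm w < 1 -> nm (z - w) < h -> nm (phi z - phi w) < e.
Proof.
move=> e0; have e2 : 0 < e / 2 by rewrite divr_gt0.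
have [h /andP[h0 h1] Hh] := geodesic_near_circle e2.
have r1 : 1 - h / 2 < 1 by lra.
have [k k0 Hk] := geodesic_uniform_inside r1 e0.
exists (Num.min k (h / 4)); first by rewrite lt_min k0 divr_gt0.
move=> z w z1 w1; rewrite lt_min => /andP[zk zh].
have [wr|wr] := lerP (nm w) (1 - h / 2); first exact: Hk.
have [zr|zr] := lerP (nm z) (1 - h / 2).
  by rewrite nm_distC; apply: Hk => //; rewrite nm_distC.
have zpos : 0 < nm z by lra.
(* The radial projection of z to the circle of radius 1 - h. It is within 2 h of w as well, so it
   serves as comparison point for both. *)
pose u : Cx R := ((1 - h) / nm z)%:C%C * z.
have nu : nm u = 1 - h.
  by rewrite nmM nm_real ger0_norm ?divr_ge0 ?divfK ?gt_eqF//; lra.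
have uz : nm (u - z) <= h.
  have -> : u - z = (((1 - h) / nm z) - 1)%:C%C * z.
    by apply: eqC; rewrite /u !ReImE /=; ring.
  rewrite nmM nm_real -{2}(gtr0_norm zpos) -normrM mulrBl divfK ?gt_eqF// mul1r.
  by rewrite ler_norml; lra.
have H1 : nm (phi u - phi z) < e / 2 by apply: Hh; lra.
have H2 : nm (phi u - phi w) < e / 2.
  by apply: Hh; try lra; have := nm_triangle z u w; lra.
by have := nm_triangle (phi u) (phi z) (phi w); rewrite (nm_distC (phi z) (phi u)); lra.
Qed.

(** On the circle, compactness of the closure of Omega supplies a cluster value, and uniform
    continuity turns it into a limit. *)
Lemma geodesic_limit z : closure (unit_disc R) z -> exists l,
  (forall e : R, 0 < e -> exists2 h : R, 0 < h &
     forall w, nm w < 1 -> nm (w - z) < h -> nm (phi w - l) < e) /\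
  (nm z < 1 -> l = phi z).
Proof.
move=> cz; have [z1|z1] := ltP (nm z) 1.
  exists (phi z); split => // e e0.
  have [h h0 Hh] := (continuous_nmP _ _).1 (geodesic_continuous z1) e e0.
  by exists h => // w _; exact: Hh.
have PW := within_nbhs_proper cz.
have FO : (phi @ within (unit_disc R) (nbhs z)) (closure Omega).
  apply: (nbhs_nmP z [set w : Cx R | unit_disc R w -> closure Omega (phi w)]).2.
  exists 1 => // w _ /unit_discE w1; exact/subset_closure/geodesic_in.
have [l [_ cl]] := compact_closure_domain boundO _ FO.
exists l; split => // e e0; have e2 : 0 < e / 2 by rewrite divr_gt0.
have [h h0 Hh] := geodesic_uniform e2.
have [||v [[w [w1 wz] wv] vl]] := cl (phi @` [set w | nm w < 1 /\ nm (w - z) < h / 2])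
    [set v | nm (v - l) < e / 2].
- apply: (nbhs_nmP z [set w : Cx R | unit_disc R w ->
    (phi @` [set w | nm w < 1 /\ nm (w - z) < h / 2]) (phi w)]).2.
  by exists (h / 2); rewrite ?divr_gt0// => w wz /unit_discE w1; exists w.
- by apply/nbhs_nmP; exists (e / 2).
exists (h / 2); first by rewrite divr_gt0.
move=> w' w'1 w'z; move: vl; rewrite -wv /= => vl.
have ww : nm (w' - w) < h.
  by have := nm_triangle z w' w; rewrite (nm_distC z w); lra.
by have := Hh w' w w'1 w1 ww; have := nm_triangle (phi w) (phi w') l; lra.
Qed.

End Geodesic.

Theorem corollary2p20 (R : realType) (d : nat) (d_gt0 : (0 < d)%N)
    (Omega : set 'rV[Cx R]_d) (alpha : R)
    (alpha_gt0 : 0 < alpha) (alpha_le1 : alpha <= 1)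
    (Omega_domain : domain Omega)
    (Omega_bounded : bounded_set Omega)
    (Omega_Csc : C_strictly_convex Omega)
    (Omega_C1alpha : C1_holder_boundary alpha Omega)
    (phi : Cx R -> 'rV[Cx R]_d)
    (phi_geodesic : complex_geodesic Omega phi) :
  exists phibar : Cx R -> 'rV[Cx R]_d,
    [/\ {within closure (unit_disc R), continuous phibar},
        forall z, unit_disc R z -> phibar z = phi z &
        forall z, closure (unit_disc R) z -> closure Omega (phibar z)].
Proof.
have [openO _ _] := Omega_domain.
have [B boundO] := bounded_set_nm Omega_bounded.
have lim z : exists l, closure (unit_disc R) z ->
    (forall e : R, 0 < e -> exists2 h : R, 0 < h &
       forall w, nm w < 1 -> nm (w - z) < h -> nm (phi w - l) < e) /\ (nm z < 1 -> l = phi z).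
  (* Off the closed disc the value 0 is arbitrary. *)
  have [cz|ncz] := pselect (closure (unit_disc R) z); last by exists 0.
  have [l Hl] := geodesic_limit d_gt0 alpha_gt0 openO Omega_Csc boundO Omega_C1alpha
    phi_geodesic cz.
  by exists l.
have [phibar Hbar] := choice lim.
exists phibar; split.
- apply/subspace_continuousP => z cz; apply/cvg_nmP => e e0.
  have [Hz _] := Hbar z cz; have [|h h0 Hh] := Hz (e / 2); first by rewrite divr_gt0.
  apply: (nbhs_nmP z [set t : Cx R | closure (unit_disc R) t -> nm (phibar t - phibar z) < e]).2.
  exists (h / 2); first by rewrite divr_gt0.
  move=> t tz /= ct; have [Ht _] := Hbar t ct.
  have [|k k0 Hk] := Ht (e / 2); first by rewrite divr_gt0.
  (* t may lie on the circle, where only limits of [phi] are known; an inner point w close to t and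
     to z links the two limits. *)
  have [|w /unit_discE w1] := (closure_nmP _ _).1 ct (Num.min k (h / 2)).
    by rewrite lt_min k0 divr_gt0.
  rewrite lt_min => /andP[wk wh].
  have wz : nm (w - z) < h by have := nm_triangle t w z; lra.
  have := Hh w w1 wz; have := Hk w w1 wk; have := nm_triangle (phi w) (phibar t) (phibar z).
  by rewrite (nm_distC (phibar t) (phi w)); lra.
- by move=> z zd; have [_ ->] := Hbar z (subset_closure zd) => //; exact/unit_discE.
- move=> z cz; have [Hz _] := Hbar z cz; apply/closure_nmP => e e0.
  have [h h0 Hh] := Hz e e0; have [w /unit_discE w1 wz] := (closure_nmP _ _).1 cz h h0.
  exists (phi w); last exact: Hh.
  by have [] := phi_geodesic.1 w ((unit_discE w).2 w1).
Qed.
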